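(* Let $\Gamma=(X,R)$, $V$, $q$, $A$, $A^*$, $B$, $B^*$, $K$, $K^*$, $\Phi$, $\Psi$ be as described in the context. Then there exists a $\boxtimes_q$-module structure on $V$ such that the generators act as follows: $x_{01}$ acts as $A\Phi\Psi^{-1}$, $x_{12}$ acts as $B\Phi^{-1}$, $x_{23}$ acts as $A^*\Phi\Psi$, $x_{30}$ acts as $B^*\Phi^{-1}$, $x_{02}$ acts as $K\Psi^{-1}$, and $x_{13}$ acts as $K^*\Psi$.
   Context: The $q$-tetrahedron algebra. For a nonzero $q\in\mathbb C$ with $q^2\neq 1$ put $[n]_q=(q^n-q^{-n})/(q-q^{-1})$. Let $\mathbb Z_4=\mathbb Z/4\mathbb Z$. The algebra $\boxtimes_q$ is the unital associative $\mathbb C$-algebra with generators $x_{ij}$ for $i,j\in\mathbb Z_4$ with $j-i\in\{1,2\}$, subject to: (1) $x_{ij}x_{ji}=1$ whenever $j-i=2$; (2) $\frac{q x_{hi}x_{ij}-q^{-1}x_{ij}x_{hi}}{q-q^{-1}}=1$ whenever $(i-h,j-i)$ is one of $(1,1),(1,2),(2,1)$; (3) $x_{hi}^3x_{jk}-[3]_q x_{hi}^2x_{jk}x_{hi}+[3]_q x_{hi}x_{jk}x_{hi}^2-x_{jk}x_{hi}^3=0$ whenever $i-h=j-i=k-j=1$. The graph. Let $\Gamma=(X,R)$ be a finite, undirected, connected graph without loops or multiple edges, with path-length distance $\partial$ and diameter $D\ge 3$. Assume $\Gamma$ is distance-regular: for $0\le h,i,j\le D$ and vertices $y,z$ with $\partial(y,z)=h$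 the number $p^h_{ij}=|\{w\in X:\partial(y,w)=i,\ \partial(w,z)=j\}|$ depends only on $h,i,j$. Put $c_i=p^i_{1,i-1}$, $b_i=p^i_{1,i+1}$. Assume there are $b,\beta\in\mathbb C$ with $b\ne1$ such that $\Gamma$ has classical parameters $(D,b,\alpha,\beta)$ with $\alpha=b-1$, i.e. $c_i=b^{i-1}\frac{b^i-1}{b-1}$ and $b_i=(\beta+1-b^i)\frac{b^D-b^i}{b-1}$ for $0\le i\le D$ (then $b$ is an integer, $b\ne 0,-1$). Fix $q\in\mathbb C$ with $b=q^2$; $q$ is nonzero and not a root of unity. Matrices and spaces. $\mathrm{Mat}_X(\mathbb C)$ denotes complex matrices with rows and columns indexed by $X$; $V=\mathbb C^X$ (the standard module) with Hermitean inner product $\langle u,v\rangle=u^t\overline{v}$. Let $A_i$ be the $i$th distance matrix ($(y,z)$-entry $1$ if $\partial(y,z)=i$, else $0$); the $A_i$ span the Bose–Mesner algebra $M$, which has a basis of primitive idempotents $E_0,\dots,E_D$. The Krein parameters $q^h_{ij}$ are defined by $E_i\circ E_j=|X|^{-1}\sum_h q^h_{ij}E_h$ ($\circ$ the entrywise product). Since $\alpha=b-1$, $\Gamma$ is formally self-dual, and the primitive idempotents are ordered $E_0,\dots,E_D$ so that $q^h_{ij}=p^h_{ij}$ for all $h,i,j$. Let $\theta_i$ be the eigenvalue of $A_1$ on $E_iV$. Fix a base vertex $x\in X$. Let $E_i^*$ be the diagonal matrix with $(y,y)$-entry $1$ if $\partial(x,y)=i$ and $0$ otherwise; let $A_1^*$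 be the diagonal matrix with $(y,y)$-entry $|X|(E_1)_{xy}$ and $\theta_i^*$ its eigenvalue on $E_i^*V$. There exist $\alpha_0,\alpha_1\in\mathbb C$ with $\alpha_1\ne0$ such that $\theta_i=\theta_i^*=\alpha_0+\alpha_1q^{D-2i}$ for $0\le i\le D$. Define $A,A^*\in\mathrm{Mat}_X(\mathbb C)$ by $A_1=\alpha_0I+\alpha_1A$ and $A_1^*=\alpha_0I+\alpha_1A^*$; so $A$ acts on $E_iV$ and $A^*$ acts on $E_i^*V$ as $q^{D-2i}$. For $-1\le i,j\le D$ define $V^{\downarrow\downarrow}_{i,j}=(E^*_0V+\cdots+E^*_iV)\cap(E_0V+\cdots+E_jV)$, $V^{\uparrow\downarrow}_{i,j}=(E^*_DV+\cdots+E^*_{D-i}V)\cap(E_0V+\cdots+E_jV)$, $V^{\downarrow\uparrow}_{i,j}=(E^*_0V+\cdots+E^*_iV)\cap(E_DV+\cdots+E_{D-j}V)$, $V^{\uparrow\uparrow}_{i,j}=(E^*_DV+\cdots+E^*_{D-i}V)\cap(E_DV+\cdots+E_{D-j}V)$, each interpreted as $0$ if $i=-1$ or $j=-1$. For $\eta,\mu\in\{\downarrow,\uparrow\}$ and $0\le i,j\le D$ let $\tilde V^{\eta\mu}_{i,j}$ be the orthogonal complement of $V^{\eta\mu}_{i-1,j}+V^{\eta\mu}_{i,j-1}$ in $V^{\eta\mu}_{i,j}$. For each $\eta,\mu$ one has $V=\sum_{i,j=0}^D\tilde V^{\eta\mu}_{i,j}$ (direct sum). Define $B,B^*,K,K^*,\Phi,\Psi\in\mathrm{Mat}_X(\mathbb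 C)$ as the unique matrices such that for all $0\le i,j\le D$: $B$ acts as $q^{i-j}$ on $\tilde V^{\downarrow\uparrow}_{i,j}$; $B^*$ acts as $q^{j-i}$ on $\tilde V^{\uparrow\downarrow}_{i,j}$; $K$ acts as $q^{i-j}$ on $\tilde V^{\downarrow\downarrow}_{i,j}$; $K^*$ acts as $q^{i-j}$ on $\tilde V^{\uparrow\uparrow}_{i,j}$; $\Phi$ acts as $q^{i+j-D}$ on $\tilde V^{\downarrow\downarrow}_{i,j}$; $\Psi$ acts as $q^{i+j-D}$ on $\tilde V^{\downarrow\uparrow}_{i,j}$. *)

(* Defs.v *)
From HB Require Import structures.
From mathcomp Require Import all_boot all_order all_algebra.
From mathcomp Require Import generic_quotient ring_quotient.
From mathcomp Require Import boolp reals complex.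
From mathcomp Require Import monalg.

Set Implicit Arguments.
Unset Strict Implicit.
Unset Printing Implicit Defensive.

Import Order.TTheory GRing.Theory Num.Theory.
Local Open Scope ring_scope.

Section QuotientAlgebra.
Variables (F : fieldType) (A : algType F) (rel : A -> Prop).
Implicit Types (f g h : A) (c : F).

Inductive gen_ideal : A -> Prop :=
| gen_ideal_rel f : rel f -> gen_ideal f
| gen_ideal0 : gen_ideal 0
| gen_idealB f g : gen_ideal f -> gen_ideal g -> gen_ideal (f - g)
| gen_idealMl h f : gen_ideal f -> gen_ideal (h * f)
| gen_idealMr h f : gen_ideal f -> gen_ideal (f * h).

Definition gen_ideal_pred : {pred A} := fun f => `[< gen_ideal f >].

Lemma gen_ideal_zmod : zmod_closed gen_ideal_pred.
Proof.
split; first by apply/asboolP; exact: gen_ideal0.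
by move=> f g /asboolP If /asboolP Ig; apply/asboolP; exact: gen_idealB.
Qed.
HB.instance Definition _ := GRing.isZmodClosed.Build A gen_ideal_pred
  gen_ideal_zmod.

Local Notation quot_ideal := (Quotient.quot gen_ideal_pred).
Definition qalg : Type := quot_ideal.
HB.instance Definition _ := GRing.Zmodule.on qalg.

Definition qalg_pi (f : A) : qalg := (\pi_(quot_ideal) f)%qT.
Definition qalg_repr (a : qalg) : A := repr (a : quot_ideal).

Lemma qalg_reprK a : qalg_pi (qalg_repr a) = a.
Proof. exact: (@reprK _ quot_ideal a). Qed.

Lemma qalg_piP f g : qalg_pi f = qalg_pi g <-> gen_ideal (f - g).
Proof.
rewrite /qalg_pi; split => [/eqmodP|H].
  by rewrite /Quotient.equiv_equiv /= /Quotient.equiv => /asboolP.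
by apply/eqmodP; rewrite /= /Quotient.equiv; apply/asboolP.
Qed.

Lemma qalg_repr_pi f : gen_ideal (qalg_repr (qalg_pi f) - f).
Proof. by apply/qalg_piP; rewrite qalg_reprK. Qed.

Lemma qalg_piD f g : qalg_pi (f + g) = qalg_pi f + qalg_pi g.
Proof. exact: (Quotient.pi_add gen_ideal_pred f g). Qed.

Lemma gen_idealD f g : gen_ideal f -> gen_ideal g -> gen_ideal (f + g).
Proof.
move=> If Ig; rewrite -[g]opprK; apply: gen_idealB => //.
by rewrite -sub0r; apply: gen_idealB => //; exact: gen_ideal0.
Qed.

Lemma gen_idealZ c f : gen_ideal f -> gen_ideal (c *: f).
Proof. by move=> If; rewrite -[f]mul1r scalerAl; exact: gen_idealMl. Qed.

Definition qalg_one : qalg := qalg_pi 1.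
Definition qalg_mul (a b : qalg) : qalg := qalg_pi (qalg_repr a * qalg_repr b).
Definition qalg_scale c (a : qalg) : qalg := qalg_pi (c *: qalg_repr a).

Lemma qalg_piM f g : qalg_mul (qalg_pi f) (qalg_pi g) = qalg_pi (f * g).
Proof.
apply/qalg_piP; set f' := qalg_repr _; set g' := qalg_repr _.
have -> : f' * g' - f * g = (f' - f) * g' + f * (g' - g).
  by rewrite mulrBl mulrBr addrA subrK.
by apply: gen_idealD; [apply: gen_idealMr|apply: gen_idealMl];
  exact: qalg_repr_pi.
Qed.

Lemma qalg_piZ c f : qalg_scale c (qalg_pi f) = qalg_pi (c *: f).
Proof.
by apply/qalg_piP; rewrite -scalerBr; apply: gen_idealZ; exact: qalg_repr_pi.
Qed.

Fact qalg_mulA : associative qalg_mul.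
Proof.
move=> a b c; rewrite -[a]qalg_reprK -[b]qalg_reprK -[c]qalg_reprK.
by rewrite !qalg_piM mulrA.
Qed.
Fact qalg_mul1 : left_id qalg_one qalg_mul.
Proof. by move=> a; rewrite -[a]qalg_reprK qalg_piM mul1r. Qed.
Fact qalg_mulr1 : right_id qalg_one qalg_mul.
Proof. by move=> a; rewrite -[a]qalg_reprK qalg_piM mulr1. Qed.
Fact qalg_mulDl : left_distributive qalg_mul +%R.
Proof.
move=> a b c; rewrite -[a]qalg_reprK -[b]qalg_reprK -[c]qalg_reprK.
by rewrite -qalg_piD !qalg_piM mulrDl qalg_piD.
Qed.
Fact qalg_mulDr : right_distributive qalg_mul +%R.
Proof.
move=> a b c; rewrite -[a]qalg_reprK -[b]qalg_reprK -[c]qalg_reprK.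
by rewrite -qalg_piD !qalg_piM mulrDr qalg_piD.
Qed.
HB.instance Definition _ := GRing.Zmodule_isPzRing.Build qalg
  qalg_mulA qalg_mul1 qalg_mulr1 qalg_mulDl qalg_mulDr.

Fact qalg_scaleA c d a : qalg_scale c (qalg_scale d a) = qalg_scale (c * d) a.
Proof. by rewrite -[a]qalg_reprK !qalg_piZ scalerA. Qed.
Fact qalg_scale1 : left_id 1 qalg_scale.
Proof. by move=> a; rewrite -[a]qalg_reprK qalg_piZ scale1r. Qed.
Fact qalg_scaleDr : right_distributive qalg_scale +%R.
Proof.
move=> c a b; rewrite -[a]qalg_reprK -[b]qalg_reprK -qalg_piD !qalg_piZ.
by rewrite scalerDr qalg_piD.
Qed.
Fact qalg_scaleDl a : {morph qalg_scale^~ a : c d / c + d}.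
Proof. by move=> c d; rewrite -[a]qalg_reprK !qalg_piZ scalerDl qalg_piD. Qed.
HB.instance Definition _ := GRing.Zmodule_isLmodule.Build F qalg
  qalg_scaleA qalg_scale1 qalg_scaleDr qalg_scaleDl.

Lemma qalg_mulE f g : qalg_pi f * qalg_pi g = qalg_pi (f * g).
Proof. exact: qalg_piM. Qed.

Lemma qalg_scaleE c f : c *: qalg_pi f = qalg_pi (c *: f).
Proof. exact: qalg_piZ. Qed.

(* MathComp's algType excludes the zero algebra, which a quotient may be, so  *)
(* qalg is only declared a ring and a vector space; by the next two lemmas it *)
(* is an F-algebra.                                                           *)
Lemma qalg_scalerAl c (a b : qalg) : c *: (a * b) = (c *: a) * b.
Proof.
rewrite -[a]qalg_reprK -[b]qalg_reprK.
by rewrite qalg_mulE !qalg_scaleE qalg_mulE scalerAl.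
Qed.

Lemma qalg_scalerAr c (a b : qalg) : c *: (a * b) = a * (c *: b).
Proof.
rewrite -[a]qalg_reprK -[b]qalg_reprK.
by rewrite qalg_mulE !qalg_scaleE qalg_mulE scalerAr.
Qed.

Definition qalg_module (V : lmodType F) (act : qalg -> V -> V) : Prop :=
  [/\ forall v, act 1 v = v,
      forall a b v, act (a * b) v = act a (act b v),
      forall c a b v, act (c *: a + b) v = c *: act a v + act b v
    & forall c a u v, act a (c *: u + v) = c *: act a u + act a v].

End QuotientAlgebra.


(* The free algebra on G is the monoid algebra of the free monoid on G.       *)
Section FreeAlgebra.
Variables (F : fieldType) (G : choiceType).

Fact malg_fmonom_scalerAr (c : F) (f g : {malg F[{fmonom G}]}) :
  c *: (f * g) = f * (c *: g).
Proof.
have cC : malgC c * f = f * malgC c.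
  rewrite !malgM_def fgmulUg fgmulgU; apply: eq_bigr => k _.
  by rewrite mulrC mul1m mulm1.
by rewrite -!mul_malgC mulrA cC mulrA.
Qed.

Definition free_alg : Type := {malg F[{fmonom G}]}.
HB.instance Definition _ := GRing.Lalgebra.on free_alg.
HB.instance Definition _ := GRing.Lalgebra_isAlgebra.Build F free_alg
  malg_fmonom_scalerAr.
Definition free_gen (x : G) : free_alg := mkmalgU (fmu x) 1.

Variables (n : nat) (X : G -> 'M[F]_n.+1).

Definition word_eval (m : {fmonom G}) : 'M[F]_n.+1 := \prod_(x <- m) X x.

Lemma word_evalM : mmorphism word_eval.
Proof.
by split=> [m1 m2|]; rewrite /word_eval ?fmM ?big_cat // fm1 big_nil.
Qed.
HB.instance Definition _ := isMultiplicative.Build _ _ word_eval word_evalM.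

Definition free_eval (f : free_alg) : 'M[F]_n.+1 :=
  mmap (@scalar_mx F n.+1) word_eval f.

Fact free_eval_is_linear : linear free_eval.
Proof.
move=> c f g; rewrite /free_eval raddfD -mul_scalar_mx; congr (_ + _).
exact: (@mmapZ {fmonom G} F 'M[F]_n.+1 (@scalar_mx F n.+1) word_eval).
Qed.
HB.instance Definition _ := GRing.isLinear.Build F free_alg 'M[F]_n.+1 _
  free_eval free_eval_is_linear.

Fact free_eval_is_monoid_morphism : monoid_morphism free_eval.
Proof.
have cX (h : {malg F[{fmonom G}]}) m m' : GRing.comm (h@_m)%:M (word_eval m').
  exact: comm_scalar_mx.
have [evM ev1] := commr_mmap_is_multiplicative cX; split; first exact: ev1.
exact: evM.
Qed.
HB.instance Definition _ := GRing.isMonoidMorphism.Build free_alg 'M[F]_n.+1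
  free_eval free_eval_is_monoid_morphism.

Lemma free_eval_gen x : free_eval (free_gen x) = X x.
Proof. by rewrite /free_eval mmapU /word_eval /= fmU big_seq1 mul1r. Qed.

End FreeAlgebra.

Lemma qalg_module_ex (F : fieldType) (A : algType F) (rel : A -> Prop) n
    (ev : {lrmorphism A -> 'M[F]_n.+1}) :
  (forall f, rel f -> ev f = 0) ->
  exists act : qalg rel -> 'cV[F]_n.+1 -> 'cV[F]_n.+1,
    qalg_module act /\ forall f v, act (qalg_pi rel f) v = ev f *m v.
Proof.
move=> rel0; pose evq (a : qalg rel) := ev (qalg_repr a).
have evE f : evq (qalg_pi rel f) = ev f.
  apply/eqP; rewrite -subr_eq0 -rmorphB; apply/eqP.
  elim: (qalg_repr_pi rel f) => [g /rel0 //||g h _ eg _ eh|h g _ eg|h g _ eg].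
  - exact: rmorph0.
  - by rewrite rmorphB eg eh subrr.
  - by rewrite rmorphM eg mulr0.
  - by rewrite rmorphM eg mul0r.
exists (fun a v => evq a *m v); split=> [|f v]; last by rewrite evE.
split.
- by move=> v; rewrite [evq 1]evE rmorph1 mul1mx.
- move=> a b v; rewrite -[a]qalg_reprK -[b]qalg_reprK qalg_mulE !evE.
  by rewrite rmorphM -mulmxA.
- move=> c a b v; rewrite -[a]qalg_reprK -[b]qalg_reprK qalg_scaleE -qalg_piD.
  by rewrite !evE linearP mulmxDl -scalemxAl.
- by move=> c a u v; rewrite mulmxDr -scalemxAr.
Qed.

Section QTet.
Variables (F : fieldType) (q : F).

Definition qint (n : nat) : F := (q ^+ n - q ^- n) / (q - q^-1).

Inductive qtet_relator (A : algType F) (x : 'Z_4 -> 'Z_4 -> A) : A -> Prop :=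
| qtet_relator1 i j : j - i = 2 -> qtet_relator x (x i j * x j i - 1)
| qtet_relator2 h i j :
    (i - h, j - i) \in [:: (1, 1); (1, 2); (2, 1)] ->
    qtet_relator x ((q - q^-1)^-1 *:
      (q *: (x h i * x i j) - q^-1 *: (x i j * x h i)) - 1)
| qtet_relator3 h i j k : i - h = 1 -> j - i = 1 -> k - j = 1 ->
    qtet_relator x (x h i ^+ 3 * x j k
      - qint 3 *: (x h i ^+ 2 * x j k * x h i)
      + qint 3 *: (x h i * x j k * x h i ^+ 2)
      - x j k * x h i ^+ 3).

Definition qtet_adj (i j : 'Z_4) : bool := (j - i == 1) || (j - i == 2).
Definition qtet_index : Type := {ij : 'Z_4 * 'Z_4 | qtet_adj ij.1 ij.2}.
HB.instance Definition _ := Choice.on qtet_index.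

(* The free generator x_ij, with the junk value 0 when j - i is not 1 or 2;   *)
(* the relators only involve genuine generators.                              *)
Definition qtet_free_gen (i j : 'Z_4) : free_alg F qtet_index :=
  oapp (@free_gen F qtet_index) 0 (insub (i, j)).

Definition qtet : Type := qalg (qtet_relator qtet_free_gen).
HB.instance Definition _ := GRing.PzRing.on qtet.
HB.instance Definition _ := GRing.Lmodule.on qtet.

Definition qtet_gen (i j : 'Z_4) : qtet := qalg_pi _ (qtet_free_gen i j).

Lemma qtet_relator_morph (A B : algType F) (ev : {lrmorphism A -> B}) x y f :
  (forall i j, qtet_adj i j -> ev (x i j) = y i j) ->
  qtet_relator x f -> qtet_relator y (ev f).
Proof.
move=> exy.
have adj1 (i j : 'Z_4) : j - i = 1 -> qtet_adj i j.
  by move=> e; rewrite /qtet_adj e eqxx.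
have adj2 (i j : 'Z_4) : j - i = 2 -> qtet_adj i j.
  by move=> e; rewrite /qtet_adj e eqxx orbT.
have adj2' (i j : 'Z_4) : j - i = 2 -> qtet_adj j i.
  by move=> e; apply: adj2; rewrite -opprB e; apply/val_inj.
have evB a b : ev (a - b) = ev a - ev b by exact: rmorphB.
have evD a b : ev (a + b) = ev a + ev b by exact: rmorphD.
have evM a b : ev (a * b) = ev a * ev b by exact: rmorphM.
have evX a k : ev (a ^+ k) = ev a ^+ k by exact: rmorphXn.
have evZ c a : ev (c *: a) = c *: ev a by exact: linearZ.
have ev1 : ev 1 = 1 by exact: rmorph1.
case=> {f}.
- move=> i j e; rewrite evB evM ev1 !exy; auto.
  exact: qtet_relator1.
- move=> h i j e; have [hi ij] : qtet_adj h i /\ qtet_adj i j.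
    by move: e; rewrite !inE !xpair_eqE => /or3P[] /andP[/eqP ? /eqP ?]; auto.
  rewrite evB evZ evB !evZ !evM ev1.
  by rewrite (exy _ _ hi) (exy _ _ ij); exact: (@qtet_relator2 B y h i j e).
- move=> h i j k hi ij jk.
  rewrite evB evD evB !evZ !(evX, evM).
  rewrite (exy _ _ (adj1 _ _ hi)) (exy _ _ (adj1 _ _ jk)).
  exact: (@qtet_relator3 B y h i j k hi ij jk).
Qed.

Lemma qtet_module_ex (n : nat) (X : 'Z_4 -> 'Z_4 -> 'M[F]_n) :
  (forall i j, j - i = 2 -> X i j *m X j i = 1%:M) ->
  (forall h i j, (i - h, j - i) \in [:: (1, 1); (1, 2); (2, 1)] ->
     (q - q^-1)^-1 *: (q *: (X h i *m X i j) - q^-1 *: (X i j *m X h i))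
       = 1%:M) ->
  (forall h i j k, i - h = 1 -> j - i = 1 -> k - j = 1 ->
     X h i ^+ 3 *m X j k
     - qint 3 *: (X h i ^+ 2 *m X j k *m X h i)
     + qint 3 *: (X h i *m X j k *m X h i ^+ 2)
     - X j k *m X h i ^+ 3 = 0) ->
  exists act : qtet -> 'cV[F]_n -> 'cV[F]_n, qalg_module act /\
    forall i j, qtet_adj i j -> forall v, act (qtet_gen i j) v = X i j *m v.
Proof.
case: n X => [X _ _ _|n X rel1 rel2 rel3].
  exists (fun _ _ => 0); split=> [|*]; last by rewrite [RHS]flatmx0.
  by split=> *; rewrite ?scaler0 ?addr0 // [RHS]flatmx0.
pose ev : {lrmorphism free_alg F qtet_index -> 'M[F]_n.+1} :=
  free_eval (fun g : qtet_index => X (val g).1 (val g).2).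
have evE i j : qtet_adj i j -> ev (qtet_free_gen i j) = X i j.
  by move=> ij; rewrite /qtet_free_gen insubT /= free_eval_gen.
have ev0 f : qtet_relator qtet_free_gen f -> ev f = 0.
  move=> /(qtet_relator_morph evE); case=> {f}.
  - by move=> i j e; rewrite [X in X - _](rel1 _ _ e) subrr.
  - by move=> h i j e; rewrite [X in X - _](rel2 _ _ _ e) subrr.
  - by move=> h i j k hi ij jk; exact: (rel3 _ _ _ _ hi ij jk).
have [act [actM actE]] := qalg_module_ex ev0.
by exists act; split=> // i j ij v; rewrite actE evE.
Qed.

End QTet.

Section Graph.
Variables (X : finType) (e : rel X).

Definition simple_graph : Prop := symmetric e /\ irreflexive e.
Definition connected_graph : Prop := forall y z, connect e y z.

(* Path-length distance; it is #|X| when no path joins y to z.                *)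
Definition gdist (y z : X) : nat :=
  find (fun n => [exists p : n.-tuple X, path e y p && (last y p == z)])
       (iota 0 #|X|).

Definition diameter : nat := \max_(y : X) \max_(z : X) gdist y z.

Definition dist_count (i j : nat) (y z : X) : nat :=
  #|[set w | (gdist y w == i) && (gdist w z == j)]|.

Definition distance_regular : Prop :=
  forall h i j y z y' z',
    (h <= diameter)%N -> (i <= diameter)%N -> (j <= diameter)%N ->
    gdist y z = h -> gdist y' z' = h ->
    dist_count i j y z = dist_count i j y' z'.

(* p^h_ij, read off from an arbitrary pair of vertices at distance h.         *)
Definition pnum (h i j : nat) : nat :=
  if [pick yz : X * X | gdist yz.1 yz.2 == h] is Some yz
  then dist_count i j yz.1 yz.2 else 0%N.

(* For i = 0 the index i.-1 is 0 instead of -1, but p^0_{1,0} = 0 as well.    *)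
Definition cnum (i : nat) : nat := pnum i 1 i.-1.
Definition bnum (i : nat) : nat := pnum i 1 i.+1.

(* Classical parameters (D, b, alpha, beta) with alpha = b - 1.               *)
Definition classical_parameters_b1 (F : fieldType) (D : nat) (b beta : F) :
    Prop :=
  forall i : nat, (i <= D)%N ->
    (cnum i)%:R = b ^ (i%:Z - 1) * ((b ^+ i - 1) / (b - 1)) /\
    (bnum i)%:R = (beta + 1 - b ^+ i) * ((b ^+ D - b ^+ i) / (b - 1)).

End Graph.

(* Mat_X(C) is 'M[C]_#|X|, with the row y : 'I_#|X| standing for the vertex   *)
(* enum_val y; the standard module is the space of column vectors.            *)
Section Matrices.
Variables (C : numClosedFieldType) (X : finType) (e : rel X).
Local Notation n := #|X|.
Local Notation dist := (gdist e).

Definition distance_mx (i : nat) : 'M[C]_n :=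
  \matrix_(y, z) (dist (enum_val y) (enum_val z) == i)%:R.

Definition bose_mesner : {vspace 'M[C]_n} :=
  <<[seq distance_mx i | i <- iota 0 (diameter e).+1]>>%VS.

Definition primitive_idempotent_in (M : {vspace 'M[C]_n}) (E : 'M[C]_n) :
    Prop :=
  [/\ E \in M, E != 0, E *m E = E
    & forall f, f \in M -> f *m f = f -> E *m f = f -> f *m E = f ->
        f = 0 \/ f = E].

Definition primitive_idempotents (E : nat -> 'M[C]_n) : Prop :=
  (forall i, (i <= diameter e)%N -> primitive_idempotent_in bose_mesner (E i))
  /\ basis_of bose_mesner [seq E i | i <- iota 0 (diameter e).+1].

Definition hadamard (A B : 'M[C]_n) : 'M[C]_n := map2_mx *%R A B.

Definition krein_parameters (E : nat -> 'M[C]_n) (kr : nat -> nat -> nat -> C) :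
    Prop :=
  forall i j, (i <= diameter e)%N -> (j <= diameter e)%N ->
    hadamard (E i) (E j) =
      n%:R^-1 *: \sum_(h < (diameter e).+1) kr h i j *: E h.

Definition dual_idempotent (x : X) (i : nat) : 'M[C]_n :=
  diag_mx (\row_y (dist x (enum_val y) == i)%:R).

Definition dual_adjacency (E : nat -> 'M[C]_n) (x : X) : 'M[C]_n :=
  diag_mx (\row_y (n%:R * E 1%N (enum_rank x) y)).

End Matrices.

Section Split.
Variables (C : numClosedFieldType) (n : nat).
Implicit Types (M : 'M[C]_n) (u v : 'cV[C]_n) (E Es : nat -> 'M[C]_n).

Definition mx_image M : {vspace 'cV[C]_n} := limg (linfun (mulmx M)).

Definition hdot u v : C := (u^T *m map_mx Num.conj v) 0 0.

Definition acts_as M (W : 'cV[C]_n -> Prop) (c : C) : Prop :=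
  forall v, W v -> M *m v = c *: v.

Inductive arrow := down | up.

(* E_0 V + ... + E_i V (down) and E_D V + ... + E_{D-i} V (up); i is an       *)
(* integer, and both sums are empty for i = -1.                               *)
Definition flag E (D : nat) (d : arrow) (i : int) : {vspace 'cV[C]_n} :=
  match d with
  | down => (\sum_(k < D.+1 | (k%:Z <= i)%R) mx_image (E k))%VS
  | up => (\sum_(k < D.+1 | (D%:Z - i <= k%:Z)%R) mx_image (E k))%VS
  end.

Definition splitV Es E D (eta mu : arrow) (i j : int) : {vspace 'cV[C]_n} :=
  (flag Es D eta i :&: flag E D mu j)%VS.

(* The orthogonal complement of V_{i-1,j} + V_{i,j-1} in V_{i,j}.             *)
Definition splitW Es E D (eta mu : arrow) (i j : int) : 'cV[C]_n -> Prop :=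
  fun v => v \in splitV Es E D eta mu i j /\
    forall w, w \in (splitV Es E D eta mu (i - 1) j
                     + splitV Es E D eta mu i (j - 1))%VS -> hdot v w = 0.

Definition acts_on_split Es E D eta mu (M : 'M[C]_n) (f : int -> int -> C) :
    Prop :=
  forall i j : nat, (i <= D)%N -> (j <= D)%N ->
    acts_as M (splitW Es E D eta mu i%:Z j%:Z) (f i%:Z j%:Z).

End Split.

(* Main.v *)
Require Import Defs.
From HB Require Import structures.
From mathcomp Require Import all_boot all_order all_algebra.
From mathcomp Require Import boolp reals complex.
From mathcomp Require Import zify ring.

(* Decompose V into orthogonal irreducible modules W for the algebra          *)
(* generated by the E_i and E*_i.  The eigenspaces of A and of A* on W give   *)
(* four flags, and irreducibility together with the tridiagonal action of A   *)
(* and A* makes any two of them opposite.  On W the matrices Phi and Psi are  *)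
(* scalar, and the matrix attached to x_ij acts as q^(d-2k) on the            *)
(* intersection of the k-th step of the i-th flag with the (d-k)-th step of   *)
(* the j-th flag.  A q-Weyl relation involving A or A* follows from the       *)
(* tridiagonal action.  In each of the remaining ones, say for (x_ij, x_jk),  *)
(* the defect commutes with x_ki, hence preserves the k-th flag, and lowers   *)
(* the j-th flag by one step, hence vanishes by oppositeness.  Likewise the   *)
(* cubic q-Serre defect q-commutes with two generators and therefore lowers   *)
(* two opposite flags by two steps, so it vanishes; in particular the q-Serre *)
(* relations between A and A* need no combinatorial proof.                    *)

Set Implicit Arguments.
Unset Strict Implicit.
Unset Printing Implicit Defensive.

Import Order.TTheory GRing.Theory Num.Theory.
Local Open Scope ring_scope.

(** * q-Weyl pairs and the cubic q-Serre relation *)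

(** The graph supplies two systems of orthogonal projections, the $E_i$ and the $E_i^*$, such that
    each of $A$, $A^*$ is tridiagonal with respect to the eigenspaces of the other. For $A$ this is
    the triangle inequality ([dual_idempotent_tri]); for $A^*$ it is the vanishing of
    $q^1_{hj}=p^1_{hj}$ when $|h-j|>1$ ([prim_dual_tri], [pnum1_far]). The values of $c_2$ and $c_3$
    show that $q$ is not a root of unity ([classical_q_nroot]), so all the eigenvalues involved are
    distinct.

    The relations are checked on one irreducible module $W$ at a time ([mulmx_irr]). Let $t_0$ and
    $t_1$ be the least $i$ with $E_iW\ne 0$ and with $E_i^*W\ne 0$. The split decomposition shows
    that both systems have the same length $d$ on $W$ and that the four flags are mutually opposite
    ([irreducible_flags]). The intersections of flags of $W$ lie in the subspaces $\tilde
    V^{\eta\mu}_{i,j}$ ([wflag_splitW]), which gives the action of the six matrices on $W$. There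
    $\Phi$ is $q^{t_0+t_1+d-D}$ and $\Psi$ is $q^{t_1-t_0}$, exactly the factors that remove $t_0$,
    $t_1$ and $D$ from the eigenvalues of the other matrices and leave $q^{d-2k}$ ([xgen_eig]). The
    defining relations then follow from [weyl_on_l], [weyl_on_r], [weyl_on_cyclic] and
    [qserre_on]. *)

Section QWeyl.
Variables (F : fieldType) (n : nat) (q : F).
Hypothesis q_neq0 : q != 0.
Implicit Types x y z t : 'M[F]_n.

Definition qweyl x y : Prop :=
  q *: (x *m y) - q^-1 *: (y *m x) = (q - q^-1)%:M.

Lemma qweyl_swap x y : qweyl x y ->
  y *m x = q ^+ 2 *: (x *m y) - (q ^+ 2 - 1)%:M.
Proof.
rewrite /qweyl => xy.
have -> : (q ^+ 2 - 1)%:M = q *: (q - q^-1)%:M :> 'M[F]_n.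
  by rewrite scale_scalar_mx mulrBr divff.
by rewrite -xy scalerBr !scalerA divff // scale1r subKr.
Qed.

Lemma qweyl_swapl x y : qweyl x y ->
  x *m y = q ^- 2 *: (y *m x) + (1 - q ^- 2)%:M.
Proof.
move/qweyl_swap => ->; rewrite scalerBr scalerA mulVf ?expf_neq0 // scale1r.
rewrite scale_scalar_mx mulrBr mulVf ?expf_neq0 // mulr1.
by rewrite addrNK.
Qed.

(** Moving [t] to the right costs a factor $q^2$ at [x] and $q^{-2}$ at [y], so the quadratic terms
    match. The linear terms left by $xy$ are $q^2$ times those left by $yx$, and the coefficient
    $q^2$ cancels them. *)
Lemma qweyl_commute x t y : qweyl x t -> qweyl t y ->
  t *m (x *m y - q ^+ 2 *: (y *m x)) = (x *m y - q ^+ 2 *: (y *m x)) *m t.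
Proof.
move=> /qweyl_swap tx /qweyl_swapl ty.
rewrite mulmxBr mulmxBl -scalemxAr -scalemxAl !mulmxA tx ty.
rewrite mulmxBl mulmxDl -!scalemxAl -!mulmxA tx ty.
rewrite mulmxDr mulmxBr -!scalemxAr !mul_mx_scalar !mul_scalar_mx.
move: (x *m (y *m t)) (y *m (x *m t)) => v w.
by apply/matrixP => i j; rewrite !mxE; field.
Qed.

(** Passing [t] through $xz$ and $zx$ leaves multiples of [z] in ratio $1:a$; the condition $la=1$
    is what cancels them. *)
Lemma qweyl_step x t z (a l : F) : qweyl x t ->
    t *m z = a *: (z *m t) -> l * a = 1 ->
  t *m (x *m z - l *: (z *m x)) =
  (q ^+ 2 * a) *: ((x *m z - l *: (z *m x)) *m t).
Proof.
move=> /qweyl_swap tx tz la.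
rewrite mulmxBr mulmxBl -scalemxAr -scalemxAl !mulmxA tx tz.
rewrite mulmxBl -!scalemxAl -!mulmxA tx tz.
rewrite mulmxBr -!scalemxAr mul_mx_scalar mul_scalar_mx.
move: (x *m (z *m t)) (z *m (x *m t)) => v w.
have a0 : a != 0 by apply: contra_eq_neq la => ->; rewrite mulr0 eq_sym oner_eq0.
have -> : l = a^-1 by rewrite -[l](mulfK a0) la mul1r.
by apply/matrixP => i j; rewrite !mxE; field.
Qed.

Definition qserre x y : 'M[F]_n :=
  x ^+ 3 *m y - qint q 3 *: (x ^+ 2 *m y *m x)
  + qint q 3 *: (x *m y *m x ^+ 2) - y *m x ^+ 3.

Hypothesis q2_neq1 : q ^+ 2 != 1.

Lemma qint3 : qint q 3 = q ^+ 2 + 1 + q ^- 2.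
Proof.
have q2 : q ^+ 2 - 1 != 0 by rewrite subr_eq0.
by rewrite /qint; field; rewrite q_neq0 -expr2.
Qed.

(* The cubic q-Serre expression is an iterated q-commutator, each stage of    *)
(* which q-commutes with t. *)
Lemma qserre_factor x y :
  let z1 := x *m y - q ^+ 2 *: (y *m x) in
  let z2 := x *m z1 - 1 *: (z1 *m x) in
  qserre x y = x *m z2 - q ^- 2 *: (z2 *m x).
Proof.
move=> z1 z2; rewrite /z2 /z1 /qserre qint3 scale1r !exprS expr0 !mulr1 -!mulmxE.
rewrite !(mulmxBl, mulmxBr, scalerBr, =^~ scalemxAl, =^~ scalemxAr) -!mulmxA.
move: (x *m (x *m (x *m y))) (x *m (x *m (y *m x))) => a b.
move: (x *m (y *m (x *m x))) (y *m (x *m (x *m x))) => c d.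
by apply/matrixP => i j; rewrite !mxE; field.
Qed.

(** Along the three stages of [qserre_factor] the factor picked up by [t] goes from $1$ to $q^2$ to
    $q^4$, and the constants $1$ and $q^{-2}$ in the last two stages are the inverses that
    [qweyl_step] requires. *)
Lemma qserre_swap x t y : qweyl x t -> qweyl t y ->
  t *m qserre x y = q ^+ 4 *: (qserre x y *m t).
Proof.
move=> xt ty; rewrite qserre_factor.
set z1 := x *m y - _; set z2 := x *m z1 - _.
have tz1 : t *m z1 = 1 *: (z1 *m t) by rewrite scale1r; apply: qweyl_commute.
have tz2 := qweyl_step xt tz1 (mul1r 1).
rewrite mulr1 -/z2 in tz2; clearbody z2.
have l2 : q ^- 2 * q ^+ 2 = 1 by rewrite mulVf ?expf_neq0.
by rewrite (qweyl_step xt tz2 l2) -exprD.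
Qed.

Lemma qweyl_tr x y : qweyl x y <-> qweyl y^T x^T.
Proof.
have tr : (q *: (x *m y) - q^-1 *: (y *m x))^T =
    q *: (y^T *m x^T) - q^-1 *: (x^T *m y^T).
  by rewrite linearB /= !linearZ /= !trmx_mul.
rewrite /qweyl -tr; split=> [->|xy]; first exact: tr_scalar_mx.
by apply: trmx_inj; rewrite xy tr_scalar_mx.
Qed.

(** Transposition reverses products: it exchanges the two entries of a q-Weyl pair and changes the
    sign of the cubic expression, which reduces this to [qserre_swap]. *)
Lemma qserre_swapV x t y : qweyl y t -> qweyl t x ->
  t *m qserre x y = q ^- 4 *: (qserre x y *m t).
Proof.
move=> yt tx.
have trS : (qserre x y)^T = - qserre x^T y^T.
  rewrite /qserre !exprS expr0 !mulr1 -!mulmxE.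
  rewrite linearB /= linearD /= linearB /= !linearZ /=.
  rewrite !(trmx_mul, mulmxA); move: (qint q 3) => c.
  set a := x^T *m x^T *m x^T *m y^T; set b := x^T *m x^T *m y^T *m x^T.
  set d := x^T *m y^T *m x^T *m x^T; set e := y^T *m _ *m _ *m _.
  by apply/matrixP => i j; rewrite !mxE; ring.
have := qserre_swap (iffLR (qweyl_tr t x) tx) (iffLR (qweyl_tr y t) yt).
move=> /(congr1 (fun z => - z)); rewrite -mulmxN -scalerN -mulNmx -trS.
move=> tSt; have -> : qserre x y *m t = q ^+ 4 *: (t *m qserre x y).
  by apply: trmx_inj; rewrite linearZ /= !trmx_mul tSt.
by rewrite scalerA mulVf ?expf_neq0 // scale1r.
Qed.

End QWeyl.

(** * Opposite flags *)

Section EigenComponents.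
Variables (F : fieldType) (n : nat) (a : 'M[F]_n) (I : eqType) (chi : I -> F).

(** With [U] zero this is the independence of eigenvectors; with [U] a submodule it recovers the
    stability under spectral projections from that under the matrix. Applying $a-\chi(i_0)$ removes
    one summand and rescales the others by nonzero factors. *)
Lemma eig_comp (U : {vspace 'cV[F]_n}) (s : seq I) (v : I -> 'cV[F]_n) :
    (forall u, u \in U -> a *m u \in U) ->
    uniq s -> {in s &, injective chi} ->
    {in s, forall i, a *m v i = chi i *: v i} ->
  \sum_(i <- s) v i \in U -> {in s, forall i, v i \in U}.
Proof.
move=> aU; elim: s v => [//|i0 s IH] v /= /andP[i0s us] chiI av sU.
have rest j : j \in s -> v j \in U.
  move=> js; have ne : chi j - chi i0 != 0.
    rewrite subr_eq0; apply: contra i0s => /eqP/chiI <- //; rewrite inE ?eqxx //.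
    by rewrite js orbT.
  have : {in s, forall i, (chi i - chi i0) *: v i \in U}.
    apply: (IH (fun i => (chi i - chi i0) *: v i)) => //.
    - by move=> i k si sk; apply: chiI; rewrite inE ?si ?sk orbT.
    - move=> i si; rewrite -scalemxAr av ?inE ?si ?orbT //.
      by rewrite !scalerA mulrC.
    - have := memvB (aU _ sU) (memvZ (chi i0) sU).
      rewrite !big_cons mulmxDr scalerDr av ?mem_head // opprD addrACA subrr.
      rewrite add0r mulmx_sumr scaler_sumr -sumrB.
      rewrite [X in X \in _ -> _]big_seq [X in _ -> X \in _]big_seq.
      rewrite (eq_bigr (fun i => (chi i - chi i0) *: v i)) // => i si.
      by rewrite av ?inE ?si ?orbT // scalerBl.
  by move=> /(_ j js)/(memvZ (chi j - chi i0)^-1); rewrite scalerA mulVf ?scale1r.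
move=> i; rewrite inE => /predU1P[->|/rest //].
move: sU; rewrite big_cons => sU; rewrite -[v i0](addrK (\sum_(j <- s) v j)).
by apply: memvB => //; rewrite big_seq; apply: memv_suml => j; apply: rest.
Qed.

End EigenComponents.

Section OppositeFlags.
Variables (F : fieldType) (n : nat) (I : eqType) (W : {vspace 'cV[F]_n}).
Variables (Fl : I -> int -> {vspace 'cV[F]_n}) (d : nat).
Implicit Types (i j h k : I) (u v w : 'cV[F]_n) (c : nat -> 'cV[F]_n).

Definition flag_decomposition i j c : Prop :=
  forall l : nat, (l <= d)%N -> c l \in Fl i l /\ c l \in Fl j (d%:Z - l%:Z).

(** [flag_opp] and [flag_dec] together make [W] the direct sum of the intersections of step $l$ of
    one flag with step $d-l$ of the other. Integer indices let a flag be lowered past step $0$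
    without case distinctions. *)
Record opposite_flags : Prop := OppositeFlags {
  flag_sub : forall i m, (Fl i m <= W)%VS;
  flag_mono : forall i m m', m <= m' -> (Fl i m <= Fl i m')%VS;
  flag_opp : forall i j m m' u, i != j -> m + m' < d%:Z ->
    u \in Fl i m -> u \in Fl j m' -> u = 0;
  flag_dec : forall i j w, i != j -> w \in W ->
    exists c, flag_decomposition i j c /\ w = \sum_(l < d.+1) c l }.

Hypothesis oF : opposite_flags.

Lemma flag_memW i m u : u \in Fl i m -> u \in W.
Proof. exact: (subvP (flag_sub oF i m)). Qed.

Lemma flag_le i m m' u : m <= m' -> u \in Fl i m -> u \in Fl i m'.
Proof. by move=> /(flag_mono oF i)/subvP; apply. Qed.

(** The sum of the components with $l>m$ is [u] minus terms of step at most $m$, so it lies in step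
    $m$ of flag [i]; it also lies in step $d-m-1$ of flag [j], so it vanishes. *)
Lemma flag_dec_below i j m u : i != j -> u \in Fl i m ->
  exists c, [/\ flag_decomposition i j c,
    forall l : nat, m < l%:Z -> c l = 0 & u = \sum_(l < d.+1) c l].
Proof.
move=> ij uF; have [c [dc uE]] := flag_dec oF ij (flag_memW uF).
exists (fun l => if l%:Z <= m then c l else 0); split.
- by move=> l ld; case: ifP => _; rewrite ?mem0v //; apply: dc.
- by move=> l; case: lerP.
rewrite [LHS]uE (bigID (fun l : 'I_d.+1 => l%:Z <= m)) /= [X in X + _]big_mkcond.
rewrite [X in _ + X](_ : _ = 0) ?addr0 //=.
apply: (@flag_opp oF i j m (d%:Z - m - 1)) => //; first by lia.
  pose s := \sum_(l < d.+1 | l%:Z <= m) c l.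
  have -> : \sum_(l < d.+1 | ~~ (l%:Z <= m)) c l = u - s.
    rewrite uE [X in _ = X - _](bigID (fun l : 'I_d.+1 => l%:Z <= m)) /=.
    by rewrite [X in _ = X - _]addrC addrK.
  apply: memvB => //; apply: memv_suml => l lm; apply: flag_le lm _.
  by case: (dc l (ltn_ord l)).
apply: memv_suml => l; rewrite -ltNge => lm.
by case: (dc l (ltn_ord l)) => _; apply: flag_le; lia.
Qed.

Variables (i j : I) (x : 'M[F]_n) (chi : int -> F).
Hypotheses (ij : i != j) (chi_inj : injective chi).
Hypothesis x_eig : forall m u, u \in Fl i m -> u \in Fl j (d%:Z - m) ->
  x *m u = chi m *: u.

Lemma eig_flag m u : u \in Fl i m -> x *m u - chi m *: u \in Fl i (m - 1).
Proof.
move=> /(flag_dec_below ij)[c [dc c0 ->]].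
rewrite mulmx_sumr scaler_sumr -sumrB; apply: memv_suml => l _.
have [ci cj] := dc l (ltn_ord l).
rewrite (x_eig ci cj) -scalerBl.
have [lm|lm|->] := ltrgtP (l : nat)%:Z m.
- by apply/memvZ; apply: flag_le ci; lia.
- by rewrite c0 // scaler0 mem0v.
- by rewrite subrr scale0r mem0v.
Qed.

Lemma eig_flag_stable m u : u \in Fl i m -> x *m u \in Fl i m.
Proof.
move=> uF; rewrite -(subrK (chi m *: u) (x *m u)); apply: memvD.
  by apply: flag_le (eig_flag uF); lia.
exact: memvZ.
Qed.

Lemma eig_stable w : w \in W -> x *m w \in W.
Proof.
move=> /(flag_dec oF ij)[c [dc ->]]; rewrite mulmx_sumr; apply: memv_suml => l _.
by have [ci cj] := dc l (ltn_ord l); apply: (@flag_memW i l); apply: eig_flag_stable.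
Qed.

Lemma eig_memflag m w : w \in W -> x *m w = chi m *: w -> w \in Fl i m.
Proof.
move=> /(flag_dec oF ij)[c [dc ->]] xw; apply: memv_suml => l _.
have [ci cj] := dc l (ltn_ord l).
have [<- //|lm] := eqVneq (l : nat)%:Z m.
(* The equation $xw=\chi(m)w$ says that the vectors $(\chi(l)-\chi(m))c_l$ sum to zero. They are
   eigenvectors for distinct eigenvalues, so each is zero. *)
suff : (chi l - chi m) *: c l \in 0%VS.
  rewrite memv0 scaler_eq0 subr_eq0 => /orP[/eqP/chi_inj/eqP|/eqP->].
    by rewrite (negPf lm).
  exact: mem0v.
have := @eig_comp F n x 'I_d.+1 (fun l => chi l) 0%VS (index_enum _)
  (fun l => (chi l - chi m) *: c l).
apply => //.
- by move=> u; rewrite !memv0 => /eqP->; rewrite mulmx0.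
- exact: index_enum_uniq.
- by move=> l1 l2 _ _ /chi_inj[]/val_inj.
- move=> k _; have [ki kj] := dc k (ltn_ord k).
  by rewrite -scalemxAr (x_eig ki kj) !scalerA mulrC.
- under eq_bigr do rewrite scalerBl.
  rewrite sumrB -scaler_sumr -xw mulmx_sumr memv0 subr_eq0; apply/eqP.
  apply: eq_bigr => k _; have [ki kj] := dc k (ltn_ord k).
  by rewrite (x_eig ki kj).
- exact: mem_index_enum.
Qed.

Lemma eig_shift (M : 'M[F]_n) (s : int) :
    (forall w, w \in W -> M *m w \in W) ->
    (forall w m, w \in W -> x *m w = chi m *: w ->
       x *m (M *m w) = chi (m - s) *: (M *m w)) ->
  forall m u, u \in Fl i m -> M *m u \in Fl i (m - s).
Proof.
move=> MW xM m u /(flag_dec_below ij)[c [dc c0 ->]].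
rewrite mulmx_sumr; apply: memv_suml => l _.
have [ci cj] := dc l (ltn_ord l); have cW := flag_memW ci.
have [lm|lm] := lerP (l : nat)%:Z m; last by rewrite c0 // mulmx0 mem0v.
apply: (@flag_le i (l%:Z - s)); first by lia.
by apply: eig_memflag; [exact: MW | apply: xM => //; exact: x_eig].
Qed.

End OppositeFlags.

(** * The relations between matrices acting on opposite flags *)

Section FlagRelations.
Variables (F : fieldType) (n : nat) (q : F) (I : eqType).
Variables (W : {vspace 'cV[F]_n}) (Fl : I -> int -> {vspace 'cV[F]_n}).
Variables (d : nat) (x : I -> I -> 'M[F]_n).
Hypotheses (q_neq0 : q != 0) (q_nroot : forall m : int, q ^ m = 1 -> m = 0).
Hypothesis oF : opposite_flags W Fl d.
Hypothesis x_eig : forall i j, i != j -> forall (m : int) u,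
  u \in Fl i m -> u \in Fl j (d%:Z - m) ->
  x i j *m u = q ^ (d%:Z - 2 * m) *: u.
Implicit Types (h i j k l : I) (m : int) (u w : 'cV[F]_n).

Local Notation chi := (fun m : int => q ^ (d%:Z - 2 * m)).
Local Notation chi' := (fun m : int => q ^ (2 * m - d%:Z)).

Lemma exprz_inj : injective (fun m : int => q ^ m).
Proof.
move=> m1 m2 /= qm; apply/eqP; rewrite -subr_eq0; apply/eqP/q_nroot.
by rewrite expfzDr // -invr_expz qm divff // expfz_neq0.
Qed.

Lemma chi_inj : injective chi.
Proof. by move=> m1 m2 /exprz_inj; lia. Qed.

Lemma chi'_inj : injective chi'.
Proof. by move=> m1 m2 /exprz_inj; lia. Qed.

Lemma x_eig' i j : i != j -> forall m u,
  u \in Fl j m -> u \in Fl i (d%:Z - m) -> x i j *m u = chi' m *: u.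
Proof.
move=> ij m u uj ui; rewrite (x_eig ij ui).
  by congr (_ ^ _ *: _); lia.
by have -> : d%:Z - (d%:Z - m) = m by lia.
Qed.

Lemma q2_neq1 : q ^+ 2 != 1.
Proof. by apply/eqP => /(@q_nroot 2). Qed.

Lemma chi_opp m : chi (d%:Z - m) = (chi m)^-1.
Proof. by rewrite invr_expz; congr (_ ^ _); lia. Qed.

Lemma chiD m s : chi (m + s) = q ^ (- (2 * s)) * chi m.
Proof. by rewrite -expfzDr //; congr (_ ^ _); lia. Qed.

(** On a component [u] of eigenvalue $a$ for $x_{hi}$, one has $x_{ij}u=a^{-1}u+u'$. Here [u'] is
    one step lower in flag [i] by [eig_flag] and at most one step higher in flag [h] by hypothesis,
    so it is an $x_{hi}$-eigenvector with eigenvalue $q^{-2}a$. The terms in [u'] then cancel. *)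
Lemma weyl_on_l h i j : h != i -> i != j ->
    (forall m u, u \in Fl h m -> x i j *m u \in Fl h (m + 1)) ->
  forall w, w \in W ->
    (q *: (x h i *m x i j) - q^-1 *: (x i j *m x h i)) *m w =
    (q - q^-1) *: w.
Proof.
move=> hi ij xh w /(flag_dec oF hi)[c [dc ->]].
rewrite mulmx_sumr scaler_sumr; apply: eq_bigr => l _.
have [ch ci] := dc l (ltn_ord l); move: (c l) (l%:Z : int) ch ci => u m uh ui.
have y_eig := eig_flag oF ij (x_eig ij) ui.
set u' := _ - _ in y_eig.
have yu : x i j *m u = u' + (chi m)^-1 *: u by rewrite -chi_opp subrK.
have u'h : u' \in Fl h (m + 1).
  by apply: memvB; [exact: xh | apply/memvZ; apply: (flag_le oF _ uh); lia].
have xu' : x h i *m u' = (q ^ (-2) * chi m) *: u'.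
  rewrite (x_eig hi u'h); first by rewrite -(chiD m 1).
  by have <- : d%:Z - m - 1 = d%:Z - (m + 1) by lia.
rewrite mulmxBl -!scalemxAl -!mulmxA (x_eig hi uh ui) -scalemxAr yu.
rewrite mulmxDr -scalemxAr xu' (x_eig hi uh ui).
have : chi m != 0 by exact: expfz_neq0.
rewrite -exprnN; move: (chi m) => a a0.
by apply/matrixP => r s; rewrite !mxE; field; rewrite q_neq0.
Qed.

Lemma weyl_on_r h i j : h != i -> i != j ->
    (forall m u, u \in Fl j m -> x h i *m u \in Fl j (m + 1)) ->
  forall w, w \in W ->
    (q *: (x h i *m x i j) - q^-1 *: (x i j *m x h i)) *m w =
    (q - q^-1) *: w.
Proof.
move=> hi ij xj w /(flag_dec oF ij)[c [dc ->]].
rewrite mulmx_sumr scaler_sumr; apply: eq_bigr => l _.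
have [ci cj] := dc l (ltn_ord l); move: (c l) (l%:Z : int) ci cj => u m ui uj.
have ih : i != h by rewrite eq_sym.
have x_eigi := eig_flag oF ih (x_eig' hi) ui.
set u' := _ - _ in x_eigi.
have xu : x h i *m u = u' + (chi m)^-1 *: u.
  by rewrite invr_expz opprB subrK.
have u'j : u' \in Fl j (d%:Z - (m - 1)).
  apply: memvB; last by apply/memvZ; apply: (flag_le oF _ uj); lia.
  have -> : d%:Z - (m - 1) = d%:Z - m + 1 by lia.
  exact: xj.
have yu' : x i j *m u' = (q ^+ 2 * chi m) *: u'.
  rewrite (x_eig ij x_eigi u'j) (chiD m (-1)); congr (_ *: _).
rewrite mulmxBl -!scalemxAl -!mulmxA (x_eig ij ui uj) -scalemxAr xu.
rewrite mulmxDr -scalemxAr yu' (x_eig ij ui uj).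
have : chi m != 0 by exact: expfz_neq0.
move: (chi m) => a a0.
by apply/matrixP => r s; rewrite !mxE; field; rewrite q_neq0.
Qed.

Lemma weyl_on_cyclic i j k : i != j -> j != k -> k != i ->
    qweyl q (x j k) (x k i) -> qweyl q (x k i) (x i j) ->
  forall w, w \in W ->
    (q *: (x i j *m x j k) - q^-1 *: (x j k *m x i j)) *m w =
    (q - q^-1) *: w.
Proof.
move=> ij jk ki wjk wki; have kj : k != j by rewrite eq_sym.
have ji : j != i by rewrite eq_sym.
have comm := qweyl_commute q_neq0 wjk wki.
set Z := x j k *m x i j - _ in comm.
(* On each quotient of consecutive steps of flag [j], the matrices $x_{jk}$ and $x_{ij}$ act as
   mutually inverse scalars, so [Z] acts as $1-q^2$ and [N] lowers flag [j]. The goal is [N] $=0$ on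
   [W], since the desired left side is $-q^{-1}Z$. *)
pose N := Z - (1 - q ^+ 2)%:M.
have xj := eig_flag oF jk (x_eig jk); have xj' := eig_flag oF ji (x_eig' ij).
have sj := eig_flag_stable oF jk (x_eig jk).
have sj' := eig_flag_stable oF ji (x_eig' ij).
have Nj m u : u \in Fl j m -> N *m u \in Fl j (m - 1).
  move=> uj; have := xj m u uj; have := xj' m u uj.
  set u2 := _ - _ => u2j; set u1 := _ - _ => u1j.
  have X1 : x j k *m u = chi m *: u + u1 by rewrite addrC subrK.
  have Y1 : x i j *m u = (chi m)^-1 *: u + u2.
    by rewrite invr_expz opprB addrC subrK.
  have -> : N *m u = (chi m)^-1 *: u1 + x j k *m u2
      - (q ^+ 2 * chi m) *: u2 - q ^+ 2 *: (x i j *m u1).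
    rewrite /N /Z !mulmxBl -scalemxAl -!mulmxA mul_scalar_mx X1 Y1.
    rewrite !mulmxDr -!scalemxAr X1 Y1.
    have : chi m != 0 by exact: expfz_neq0.
    move: (chi m) => a a0; move: (x j k *m u2) (x i j *m u1) => v1 v2.
    by apply/matrixP => r s; rewrite !mxE; field.
  do 2?[apply: memvB]; last by apply/memvZ/sj'.
    by apply: memvD; [exact: memvZ | exact: sj].
  exact: memvZ.
have NW w : w \in W -> N *m w \in W.
  move=> wW; rewrite /N /Z !mulmxBl -scalemxAl -!mulmxA mul_scalar_mx.
  have sX := eig_stable oF jk (x_eig jk); have sY := eig_stable oF ij (x_eig ij).
  by apply: memvB; [apply: memvB; last apply: memvZ|apply: memvZ]; auto.
have Nk m u : u \in Fl k m -> N *m u \in Fl k m.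
  rewrite -[X in _ -> _ \in Fl k X]subr0.
  apply: (eig_shift oF ki chi_inj (x_eig ki)) => // w m' wW xw.
  rewrite subr0 mulmxA /N mulmxBr comm -mul_scalar_mx.
  by rewrite scalar_mxC -mulmxBl -mulmxA xw -scalemxAr mul_scalar_mx.
move=> w wW; have Nw0 : N *m w = 0.
  have [c [dc ->]] := flag_dec oF kj wW.
  rewrite mulmx_sumr big1 // => l _; have [ck cj] := dc l (ltn_ord l).
  by apply: (flag_opp oF kj _ (Nk _ _ ck) (Nj _ _ cj)); lia.
have Zw : Z *m w = (1 - q ^+ 2) *: w.
  by apply/eqP; rewrite -subr_eq0 -mul_scalar_mx -mulmxBl; apply/eqP.
have -> : q *: (x i j *m x j k) - q^-1 *: (x j k *m x i j) = - q^-1 *: Z.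
  rewrite /Z; move: (x i j *m _) (x j k *m _) => v1 v2.
  by apply/matrixP => r s; rewrite !mxE; field.
rewrite -scalemxAl Zw scalerA; congr (_ *: _).
by field.
Qed.

(** The factors $q^4$ and $q^{-4}$ are two steps for $x_{jk}$ on flag [j] and for $x_{li}$ on flag
    [i]. The defect sends a component with steps adding up to $d$ to one with steps adding up to
    $d-4$. *)
Lemma qserre_on i j k l : i != j -> j != k -> l != i ->
    qweyl q (x i j) (x j k) -> qweyl q (x j k) (x k l) ->
    qweyl q (x k l) (x l i) -> qweyl q (x l i) (x i j) -> k != l ->
  forall w, w \in W -> qserre q (x i j) (x k l) *m w = 0.
Proof.
move=> ij jk li wij wjk wkl wli kl; set S := qserre _ _ _.
have il : i != l by rewrite eq_sym.
have S1 : x j k *m S = q ^+ 4 *: (S *m x j k).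
  exact: (qserre_swap q_neq0 q2_neq1 wij wjk).
have S2 : x l i *m S = q ^- 4 *: (S *m x l i).
  exact: (qserre_swapV q_neq0 q2_neq1 wkl wli).
have sX := eig_stable oF ij (x_eig ij); have sY := eig_stable oF kl (x_eig kl).
have SW w : w \in W -> S *m w \in W.
  move=> wW; rewrite /S /qserre !exprS expr0 !mulr1 -!mulmxE.
  rewrite !(mulmxDl, mulNmx) -!scalemxAl -!mulmxA.
  by do ?[apply: memvD | rewrite memvN | apply: memvZ]; auto 6.
have Sj m u : u \in Fl j m -> S *m u \in Fl j (m - 2).
  apply: (eig_shift oF jk chi_inj (x_eig jk)) => // v m' vW xv.
  rewrite mulmxA S1 -scalemxAl -mulmxA xv -scalemxAr scalerA; congr (_ *: _).
  by rewrite [RHS]chiD.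
have Si m u : u \in Fl i m -> S *m u \in Fl i (m - 2).
  apply: (eig_shift oF il chi'_inj (x_eig' li)) => // v m' vW xv.
  rewrite mulmxA S2 -scalemxAl -mulmxA xv -scalemxAr scalerA; congr (_ *: _).
  by rewrite -[q ^- 4]/(q ^ (-4)) -expfzDr //; congr (_ ^ _); lia.
move=> w /(flag_dec oF ij)[c [dc ->]].
rewrite mulmx_sumr big1 // => r _; have [ci cj] := dc r (ltn_ord r).
by apply: (flag_opp oF ij _ (Si _ _ ci) (Sj _ _ cj)); lia.
Qed.

End FlagRelations.

(** * Irreducibility makes flags opposite *)

Section SplitOpposite.
Variables (F : fieldType) (n : nat) (W : {vspace 'cV[F]_n}).
Implicit Types (U : {vspace 'cV[F]_n}) (u w : 'cV[F]_n).

(** The last two conditions make $0$ and [d] the exact ends of the flag, so that the lengths of two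
    flags can be compared. *)
Record full_flag (P : int -> {vspace 'cV[F]_n}) (d : nat) : Prop := FullFlag {
  ff_sub : forall m, (P m <= W)%VS;
  ff_mono : forall m m', m <= m' -> (P m <= P m')%VS;
  ff_neg : forall m, m < 0 -> P m = 0%VS;
  ff_top : P d = W;
  ff_pretop : P (d%:Z - 1) <> W;
  ff_bot : P 0 <> 0%VS }.

Variables (a a' : 'M[F]_n) (P Q : int -> {vspace 'cV[F]_n}) (dP dQ : nat).
Variables (th th' : int -> F).
Hypotheses (fP : full_flag P dP) (fQ : full_flag Q dQ).
Hypothesis irrW : forall U, (U <= W)%VS ->
  (forall u, u \in U -> a *m u \in U) ->
  (forall u, u \in U -> a' *m u \in U) -> U = 0%VS \/ U = W.
Hypothesis aP : forall m u, u \in P m -> a *m u \in P (m + 1).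
Hypothesis aQ : forall m u, u \in Q m -> a *m u - th m *: u \in Q (m - 1).
Hypothesis a'Q : forall m u, u \in Q m -> a' *m u \in Q (m + 1).
Hypothesis a'P : forall m u, u \in P m -> a' *m u - th' m *: u \in P (m - 1).

(** Each of [a], [a'] raises one of the two flags and, up to a scalar, lowers the other, so it moves
    a summand of [G m] into itself plus a neighbour. Thus [G m] is a submodule, and irreducibility
    leaves only $0$ and [W]. *)
Let G (m : nat) : {vspace 'cV[F]_n} :=
  (\sum_(k < m.+1) (P k :&: Q (m%:Z - k%:Z)))%VS.

Let mem_ff R d (fR : full_flag R d) m m' u :
  m <= m' -> u \in R m -> u \in R m'.
Proof. by move=> mm'; apply/subvP/(ff_mono fR). Qed.

Let mem_G m k k' u : k + k' = m%:Z -> u \in P k -> u \in Q k' -> u \in G m.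
Proof.
move=> km uP uQ; have [k_lt0|k_ge0] := ltrP k 0.
  by move: uP; rewrite (ff_neg fP) // memv0 => /eqP->; exact: mem0v.
have [k'_lt0|k'_ge0] := ltrP k' 0.
  by move: uQ; rewrite (ff_neg fQ) // memv0 => /eqP->; exact: mem0v.
have km1 : (`|k| < m.+1)%N by lia.
apply: (subvP (sumv_sup (Ordinal km1) _ (subvv _))) => //=.
have -> : m%:Z - `|k|%:Z = k' by lia.
by rewrite memv_cap gez0_abs // uP.
Qed.

Let G_stable_a m u : u \in G m -> a *m u \in G m.
Proof.
move=> /memv_sumP[v vG ->]; rewrite mulmx_sumr; apply: memv_suml => k _.
have := vG k isT; rewrite memv_cap => /andP[vP vQ].
rewrite -(subrK (th (m%:Z - k%:Z) *: v k) (a *m v k)); apply: memvD.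
  apply: (@mem_G m (k%:Z + 1) (m%:Z - k%:Z - 1)); [by lia| |exact: aQ].
  apply: memvB; first exact: aP.
  by apply: memvZ; apply: (mem_ff fP) vP; lia.
by apply: memvZ; apply: mem_G vP vQ; lia.
Qed.

Let G_stable_a' m u : u \in G m -> a' *m u \in G m.
Proof.
move=> /memv_sumP[v vG ->]; rewrite mulmx_sumr; apply: memv_suml => k _.
have := vG k isT; rewrite memv_cap => /andP[vP vQ].
rewrite -(subrK (th' k%:Z *: v k) (a' *m v k)); apply: memvD.
  apply: (@mem_G m (k%:Z - 1) (m%:Z - k%:Z + 1)); [by lia|exact: a'P|].
  apply: memvB; first exact: a'Q.
  by apply: memvZ; apply: (mem_ff fQ) vQ; lia.
by apply: memvZ; apply: mem_G vP vQ; lia.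
Qed.

Let G_0W m : G m = 0%VS \/ G m = W.
Proof.
apply: irrW => [|u|u]; [|exact: G_stable_a|exact: G_stable_a'].
apply/subv_sumP => k _; apply: subv_trans (capvSl _ _) _; exact: (ff_sub fP).
Qed.

Let sub_pretop R d m : full_flag R d -> (m < d)%N -> (W <= R m)%VS -> False.
Proof.
move=> fR md WR; apply: (ff_pretop fR); apply/eqP.
rewrite eqEsubv (ff_sub fR) /=; apply: subv_trans WR _.
by apply: (ff_mono fR); lia.
Qed.

(** For small $m$ all summands lie in a proper step of one of the flags, so [G m] is not [W]. *)
Let G_lt m : (m < dQ)%N || (m < dP)%N -> G m = 0%VS.
Proof.
case: (G_0W m) => // GW /orP[md|md]; exfalso.
  apply: (sub_pretop fQ md); rewrite -GW; apply/subv_sumP => k _.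
  by apply: subv_trans (capvSr _ _) _; apply: (ff_mono fQ); lia.
apply: (sub_pretop fP md); rewrite -GW; apply/subv_sumP => k _.
by apply: subv_trans (capvSl _ _) _; apply: (ff_mono fP); have := ltn_ord k; lia.
Qed.

Let le_dPQ : (dP <= dQ)%N.
Proof.
rewrite leqNgt; apply/negP => lt; have G0 : G dQ = 0%VS by rewrite G_lt ?lt ?orbT.
apply: (ff_bot fP); apply/eqP; rewrite -subv0 -G0; apply/subvP => u uP.
apply: (@mem_G dQ 0 dQ); [by lia|by []|].
by rewrite (ff_top fQ); apply: (subvP (ff_sub fP 0)).
Qed.

Lemma split_diameter : dP = dQ.
Proof.
apply/eqP; rewrite eqn_leq le_dPQ /= leqNgt; apply/negP => lt.
have G0 : G dP = 0%VS by rewrite G_lt ?lt.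
apply: (ff_bot fQ); apply/eqP; rewrite -subv0 -G0; apply/subvP => u uQ.
apply: (@mem_G dP dP 0); [by lia| |by []].
by rewrite (ff_top fP); apply: (subvP (ff_sub fQ 0)).
Qed.

Lemma split_opp m m' u :
  m + m' < dQ%:Z -> u \in P m -> u \in Q m' -> u = 0.
Proof.
move=> mm' uP uQ.
have [m_lt0|m_ge0] := ltrP m 0.
  by move: uP; rewrite (ff_neg fP) // memv0 => /eqP.
have [m'_lt0|m'_ge0] := ltrP m' 0.
  by move: uQ; rewrite (ff_neg fQ) // memv0 => /eqP.
have G0 : G `|(m + m')%R|%N = 0%VS by apply: G_lt; apply/orP; left; lia.
by apply/eqP; rewrite -memv0 -G0; apply: mem_G uP uQ; lia.
Qed.

Lemma split_dec w : w \in W -> exists c : nat -> 'cV[F]_n,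
  (forall l : nat, (l <= dQ)%N -> c l \in P l /\ c l \in Q (dQ%:Z - l%:Z)) /\
  w = \sum_(l < dQ.+1) c l.
Proof.
move=> wW; have GW : G dQ = W.
  case: (G_0W dQ) => // G0; case: (ff_bot fP).
  apply/eqP; rewrite -subv0 -G0; apply/subvP => u uP.
  apply: (@mem_G dQ 0 dQ); [by lia|by []|].
  by rewrite (ff_top fQ); apply: (subvP (ff_sub fP 0)).
move: wW; rewrite -GW => /memv_sumP[v vG ->].
exists (fun l => v (inord l)); split=> [l ld|].
  by have := vG (inord l) isT; rewrite inordK ?ltnS // memv_cap => /andP.
by apply: eq_bigr => l _; rewrite inord_val.
Qed.

End SplitOpposite.

(** * Orthogonal complements *)

Section ColumnVectors.
Variables (C : numClosedFieldType) (n : nat).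
Implicit Types (M N : 'M[C]_n) (u v : 'cV[C]_n).

Lemma mulmx_ext M N : (forall v : 'cV_n, M *m v = N *m v) -> M = N.
Proof.
move=> MN; apply/matrixP => i j; have := MN (delta_mx j 0).
by rewrite -!colE => /colP/(_ i); rewrite !mxE.
Qed.

Lemma mx_imageP M u : reflect (exists v, u = M *m v) (u \in mx_image M).
Proof.
apply: (iffP memv_imgP) => [[v _ ->]|[v ->]]; exists v; rewrite ?lfunE //.
exact: memvf.
Qed.

Lemma surj_unitmx M : (forall v, exists u, M *m u = v) ->
  M \in unitmx.
Proof.
move=> Msurj; have [f Mf] := choice (fun j => Msurj (col j 1%:M)).
suff : M *m (\matrix_(i, j) f j i 0) = 1%:M by case/mulmx1_unit.
apply/matrixP => i j; have /colP/(_ i) := Mf j; rewrite !mxE => <-.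
by apply: eq_bigr => k _; rewrite mxE.
Qed.

End ColumnVectors.

Section HermitianDot.
Variables (C : numClosedFieldType) (n : nat).
Implicit Types (u v w : 'cV[C]_n) (M : 'M[C]_n) (W : {vspace 'cV[C]_n}).

Lemma hdotE u v : hdot u v = \sum_i u i 0 * (v i 0)^*.
Proof. by rewrite /hdot mxE; apply: eq_bigr => i _; rewrite !mxE. Qed.

Lemma hdotDl u v w : hdot (u + v) w = hdot u w + hdot v w.
Proof. by rewrite /hdot linearD /= mulmxDl mxE. Qed.

Lemma hdotZl c u v : hdot (c *: u) v = c * hdot u v.
Proof. by rewrite /hdot linearZ /= -scalemxAl mxE. Qed.

Lemma hdot_conj u v : (hdot u v)^* = hdot v u.
Proof.
rewrite !hdotE rmorph_sum /=; apply: eq_bigr => i _.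
by rewrite rmorphM /= conjCK mulrC.
Qed.

Lemma hdotDr u v w : hdot u (v + w) = hdot u v + hdot u w.
Proof. by rewrite -hdot_conj hdotDl rmorphD /= !hdot_conj. Qed.

Lemma hdotZr c u v : hdot u (c *: v) = c^* * hdot u v.
Proof. by rewrite -hdot_conj hdotZl rmorphM /= hdot_conj. Qed.

Lemma hdot0l v : hdot 0 v = 0.
Proof. by rewrite -(scale0r 0) hdotZl mul0r. Qed.

Lemma hdot0r u : hdot u 0 = 0.
Proof. by rewrite -hdot_conj hdot0l rmorph0. Qed.

Lemma hdot_sumr (I : finType) u (f : I -> 'cV[C]_n) :
  hdot u (\sum_i f i) = \sum_i hdot u (f i).
Proof. by apply: (big_morph (hdot u)); [exact: hdotDr|exact: hdot0r]. Qed.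

Lemma hdot_eq0 u : hdot u u = 0 -> u = 0.
Proof.
rewrite hdotE => /eqP; rewrite psumr_eq0 => [/allP u0|i _]; last first.
  exact: mul_conjC_ge0.
apply/colP => i; rewrite mxE; apply/eqP.
by have := u0 i (mem_index_enum _); rewrite mul_conjC_eq0.
Qed.

Lemma hdot_mulmx M u v : hdot (M *m u) v = hdot u (map_mx Num.conj M^T *m v).
Proof.
rewrite /hdot trmx_mul map_mxM -mulmxA; congr ((_ *m (_ *m _)) 0 0).
by apply/matrixP => i j; rewrite !mxE /= conjCK.
Qed.

Lemma hdot_ext (M N : 'M[C]_n) :
  (forall u v : 'cV_n, hdot u (M *m v) = hdot u (N *m v)) -> M = N.
Proof.
move=> MN; apply: mulmx_ext => v; apply/eqP; rewrite -subr_eq0; apply/eqP.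
apply: hdot_eq0; rewrite -scaleN1r hdotDr hdotZr MN.
by rewrite -hdotZr -hdotDr scaleN1r subrr hdot0r.
Qed.

(** The basis of [W] sits in the conjugate-linear argument of [hdot], which makes this map linear
    and the orthogonal complement its kernel. *)
Definition gram W v : 'rV[C]_(\dim W) := \row_i hdot v (vbasis W)`_i.

Fact gram_is_linear W : linear (gram W).
Proof.
by move=> c u v; apply/rowP => i; rewrite !mxE hdotDl hdotZl.
Qed.
HB.instance Definition _ W :=
  GRing.isLinear.Build C 'cV[C]_n 'rV[C]_(\dim W) _ (gram W) (gram_is_linear W).

Definition hdot_orth W : {vspace 'cV[C]_n} := lker (linfun (gram W)).

Lemma hdot_orthP W v : reflect (forall w, w \in W -> hdot v w = 0) (v \in hdot_orth W).
Proof.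
rewrite memv_ker lfunE /=; apply: (iffP eqP) => [gv w wW|v0].
  rewrite (coord_vbasis wW) hdot_sumr big1 // => i _.
  by have /rowP/(_ i) := gv; rewrite !mxE hdotZr => ->; rewrite mulr0.
apply/rowP => i; rewrite !mxE v0 //.
by apply: vbasis_mem; rewrite mem_nth // size_tuple.
Qed.

Lemma hdot_orth_cap W : (W :&: hdot_orth W = 0)%VS.
Proof.
apply/eqP; rewrite -subv0; apply/subvP => v.
rewrite memv_cap memv0 => /andP[vW /hdot_orthP vo].
by apply/eqP/hdot_eq0/vo.
Qed.

(** By positivity [gram W] is injective on [W], hence onto by dimension. *)
Lemma hdot_orth_proj W v : exists2 w, w \in W & v - w \in hdot_orth W.
Proof.
have /memv_imgP[w wW gw] : linfun (gram W) v \in (linfun (gram W) @: W)%VS.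
  suff -> : (linfun (gram W) @: W)%VS = fullv by exact: memvf.
  apply/eqP; rewrite eqEdim subvf limg_dim_eq ?hdot_orth_cap //= dimvf dim_matrix.
  exact: eq_leq (mul1n _).
by exists w => //; rewrite memv_ker linearB /= gw subrr.
Qed.

End HermitianDot.

(** * Modules for two dual systems of idempotents *)

Section TerwilligerModules.
Variables (C : numClosedFieldType) (n D : nat) (q : C).
Hypotheses (q_neq0 : q != 0) (q_nroot : forall m : int, q ^ m = 1 -> m = 0).

(* [false] selects the primitive idempotents E_i and the matrix A, [true]     *)
(* selects the dual idempotents E*_i and the matrix A*. *)
Variables (Eb : bool -> nat -> 'M[C]_n) (Ab : bool -> 'M[C]_n).
Hypothesis Eb_sum : forall b, \sum_(k < D.+1) Eb b k = 1%:M.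
Hypothesis Eb_mul : forall b (k l : nat), (k <= D)%N -> (l <= D)%N ->
  Eb b k *m Eb b l = if k == l then Eb b k else 0.
Hypothesis Eb_herm : forall b (k : nat) u v, (k <= D)%N ->
  hdot (Eb b k *m u) v = hdot u (Eb b k *m v).
Hypothesis Ab_Eb : forall b (k : nat), (k <= D)%N ->
  Ab b *m Eb b k = q ^ (D%:Z - 2 * k%:Z) *: Eb b k.
Hypothesis Ab_tri : forall b (k l : nat), (k <= D)%N -> (l <= D)%N ->
  (k.+1 < l)%N || (l.+1 < k)%N -> Eb b k *m Ab (~~ b) *m Eb b l = 0.
Implicit Types (b : bool) (U W : {vspace 'cV[C]_n}) (u v w : 'cV[C]_n).

Lemma Eb_dec b u : u = \sum_(k < D.+1) Eb b k *m u.
Proof. by rewrite -mulmx_suml Eb_sum mul1mx. Qed.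

Lemma Eb_act b (k l : nat) u : (k <= D)%N -> (l <= D)%N ->
  Eb b k *m (Eb b l *m u) = if k == l then Eb b k *m u else 0.
Proof. by move=> kD lD; rewrite mulmxA Eb_mul //; case: eqP; rewrite ?mul0mx. Qed.

Lemma Eb_fullP b u : (forall k : nat, (k <= D)%N -> Eb b k *m u = 0) -> u = 0.
Proof. by move=> Eu; rewrite (Eb_dec b u) big1 // => k _; rewrite Eu // leq_ord. Qed.

Lemma Ab_act b (k : nat) u : (k <= D)%N ->
  Ab b *m (Eb b k *m u) = q ^ (D%:Z - 2 * k%:Z) *: (Eb b k *m u).
Proof. by move=> kD; rewrite mulmxA Ab_Eb // -scalemxAl. Qed.

Lemma Ab_dec b u :
  Ab b *m u = \sum_(k < D.+1) q ^ (D%:Z - 2 * k%:Z) *: (Eb b k *m u).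
Proof.
rewrite {1}(Eb_dec b u) mulmx_sumr; apply: eq_bigr => k _.
by rewrite Ab_act // leq_ord.
Qed.

Lemma Eb_Ab b (k : nat) u : (k <= D)%N ->
  Eb b k *m (Ab b *m u) = q ^ (D%:Z - 2 * k%:Z) *: (Eb b k *m u).
Proof.
move=> kD; have kD1 : (k < D.+1)%N by [].
rewrite Ab_dec mulmx_sumr (bigD1 (Ordinal kD1)) //= -scalemxAr Eb_act //.
rewrite eqxx big1 ?addr0 // => l lk; rewrite -scalemxAr Eb_act ?leq_ord //.
by rewrite ifN ?scaler0 // eq_sym; apply: contra lk => /eqP e; apply/eqP/val_inj.
Qed.

Definition stable W : Prop :=
  forall b (k : nat) u, (k <= D)%N -> u \in W -> Eb b k *m u \in W.

Lemma stable_Ab W b u : stable W -> u \in W -> Ab b *m u \in W.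
Proof.
move=> sW uW; rewrite Ab_dec; apply: memv_suml => k _.
by apply/memvZ/sW => //; rewrite leq_ord.
Qed.

Lemma Ab_stable U : (forall b u, u \in U -> Ab b *m u \in U) -> stable U.
Proof.
move=> AU b k u kD uU; have kD1 : (k < D.+1)%N by [].
have := @eig_comp C n (Ab b) 'I_D.+1 (fun l => q ^ (D%:Z - 2 * l%:Z)) U
  (index_enum _) (fun l => Eb b l *m u) (AU b).
move=> /(_ (index_enum_uniq _) _ _ _ (Ordinal kD1) (mem_index_enum _)).
apply => [l1 l2 _ _ /(exprz_inj q_neq0 q_nroot) e|l _|].
- by apply: val_inj => /=; lia.
- by rewrite Ab_act // leq_ord.
- by rewrite -Eb_dec.
Qed.

Definition irreducible W : Prop :=
  [/\ W <> 0%VS, stable W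
    & forall U, (U <= W)%VS -> stable U -> U = 0%VS \/ U = W].

Lemma irreducible_sub U : stable U -> U <> 0%VS ->
  exists2 W, irreducible W & (W <= U)%VS.
Proof.
have [m] := ubnP (\dim U); elim: m U => // m IH U dU sU U0.
have [irr|] := pselect (forall W, (W <= U)%VS -> stable W -> W = 0%VS \/ W = U).
  by exists U.
move=> /existsNP[W /not_implyP[WU /not_implyP[sW /not_orP[W0 WU']]]].
have dW : (\dim W < m)%N.
  apply: (@leq_trans (\dim U)); last by rewrite -ltnS.
  rewrite ltn_neqAle dimvS // andbT.
  by apply/negP => dWU; apply: WU'; apply/eqP; rewrite -(dimv_leqif_eq WU).
have [W' irr W'W] := IH W dW sW W0.
by exists W' => //; apply: subv_trans W'W WU.
Qed.

Lemma stable_hdot_orth W : stable W -> stable (hdot_orth W).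
Proof.
move=> sW b k v kD /hdot_orthP vo; apply/hdot_orthP => w wW.
by rewrite Eb_herm // vo // sW.
Qed.

(** This is complete reducibility as an induction principle: the projections are Hermitian, so the
    complement in [U] of an irreducible submodule is again stable, of smaller dimension. *)
Lemma irreducible_ind (P : 'cV[C]_n -> Prop) :
    P 0 -> (forall u v, P u -> P v -> P (u + v)) ->
    (forall W, irreducible W -> forall w, w \in W -> P w) ->
  forall v, P v.
Proof.
move=> P0 PD Pirr v.
suff all m U : (\dim U < m)%N -> stable U -> forall u, u \in U -> P u.
  have sV : stable fullv by move=> b k u _ _; exact: memvf.
  exact: all (ltnSn _) sV v (memvf v).
elim: m U => // m IH U dU sU u uU.
have [U0|/eqP U0] := eqVneq U 0%VS; first by move: uU; rewrite U0 memv0 => /eqP->.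
have [W irrW WU] := irreducible_sub sU U0; have [W0 sW _] := irrW.
have [w wW uw] := hdot_orth_proj W u.
rewrite -(subrK w u); apply: PD; last exact: Pirr irrW _ wW.
apply: (IH (U :&: hdot_orth W)%VS); last first.
- by rewrite memv_cap uw memvB //; apply: (subvP WU).
- move=> b k y kD; rewrite !memv_cap => /andP[yU yW].
  by rewrite sU //= stable_hdot_orth.
apply: (@leq_trans (\dim U)); last by rewrite -ltnS.
rewrite ltn_neqAle dimvS ?capvSl // andbT.
rewrite (dimv_leqif_eq (capvSl _ _)); apply/eqP => capU; apply: W0.
apply/eqP; rewrite -subv0 -(hdot_orth_cap W) subv_cap subvv /=.
by apply: subv_trans WU _; rewrite -capU capvSr.
Qed.

Definition arr (m : bool) : arrow := if m then up else down.
(** The step at which index [k] enters the ascending or descending flag. *)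
Definition pos (m : bool) (k : nat) : int := if m then D%:Z - k%:Z else k%:Z.

Lemma flagP b m (j : int) u :
  u \in flag (Eb b) D (arr m) j <->
  (forall k : nat, (k <= D)%N -> j < pos m k -> Eb b k *m u = 0).
Proof.
have -> : flag (Eb b) D (arr m) j =
    (\sum_(k < D.+1 | (pos m k <= j)%R) mx_image (Eb b k))%VS.
  rewrite /flag /pos; case: m => //=; apply: eq_bigl => k.
  by rewrite lerBlDl addrC lerBlDl.
split=> [/memv_sumP[v vE ->] k kD jk|Eu].
  rewrite mulmx_sumr big1 // => l lj; have /mx_imageP[w ->] := vE l lj.
  rewrite Eb_act ?leq_ord // ifN //; apply: contraTneq jk => ->.
  by rewrite -leNgt.
rewrite (Eb_dec b u) (bigID (fun k : 'I_D.+1 => pos m k <= j)) /=.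
rewrite [X in _ + X]big1 ?addr0 => [|k]; last first.
  by rewrite -ltNge => /Eu -> //; rewrite leq_ord.
by apply: memv_sumr => k _; apply/mx_imageP; exists u.
Qed.

(** Here [t] is the endpoint and [d] the diameter of [W], or their duals when [b] is [false]. Only
    the two extreme components are asserted to be nonzero. *)
Definition support W b (t d : nat) : Prop :=
  [/\ (t + d <= D)%N,
      exists2 u, u \in W & Eb b t *m u <> 0,
      exists2 u, u \in W & Eb b (t + d) *m u <> 0
    & forall (k : nat) u, (k <= D)%N -> u \in W -> (k < t)%N || (t + d < k)%N ->
        Eb b k *m u = 0].

Lemma support_ex W b : W <> 0%VS -> exists t d, support W b t d.
Proof.
move=> W0.
pose nz k := (k <= D)%N && `[< exists2 u, u \in W & Eb b k *m u <> 0 >].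
have nzE k u : (k <= D)%N -> u \in W -> ~~ nz k -> Eb b k *m u = 0.
  move=> kD uW; rewrite /nz kD /= => /asboolPn no.
  by apply: contrapT => Eu; apply: no; exists u.
have ex_nz : exists k, nz k.
  apply: contrapT => /forallNP no; apply: W0; apply/eqP; rewrite -subv0.
  apply/subvP => u uW; rewrite memv0; apply/eqP; apply: (@Eb_fullP b) => k kD.
  by apply: nzE => //; apply/negP.
have nz_le k : nz k -> (k <= D)%N by case/andP.
case: (ex_minnP ex_nz) (ex_maxnP ex_nz nz_le) => t nt tmin [r nr rmax].
have tr := rmax _ nt; exists t, (r - t)%N; rewrite /support subnKC //.
move: nt nr => /andP[tD /asboolP nt] /andP[rD /asboolP nr].
split=> // k u kD uW ktr; apply: nzE => //; apply/negP => nk.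
by have := tmin _ nk; have := rmax _ nk; case/orP: ktr; lia.
Qed.

(** * The four flags of a stable subspace *)

Section Support.
Variables (W : {vspace 'cV[C]_n}) (t d : bool -> nat).
Hypotheses (sW : stable W) (supp : forall b, support W b (t b) (d b)).

(** The shift that makes the induced flag on [W] run from step $0$ to step $d$. *)
Definition start (i : bool * bool) : int :=
  if i.2 then D%:Z - (t i.1 + d i.1)%:Z else t i.1.

Definition wflag (i : bool * bool) (j : int) : {vspace 'cV[C]_n} :=
  (W :&: flag (Eb i.1) D (arr i.2) (start i + j))%VS.

Lemma wflagP i j u : u \in wflag i j <-> u \in W /\
  (forall k : nat, (k <= D)%N -> start i + j < pos i.2 k -> Eb i.1 k *m u = 0).
Proof. by rewrite memv_cap; split=> [/andP[-> /flagP]|[-> /flagP]]. Qed.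

Lemma wflag_sub i j : (wflag i j <= W)%VS.
Proof. exact: capvSl. Qed.

Lemma wflag_mono i j j' : j <= j' -> (wflag i j <= wflag i j')%VS.
Proof.
move=> jj'; apply/subvP => u /wflagP[uW Eu]; apply/wflagP; split=> // k kD kj.
by apply: Eu => //; apply: le_lt_trans kj; rewrite lerD2l.
Qed.

Lemma wflag_full i : full_flag W (wflag i) (d i.1).
Proof.
have [tdD [u uW Etu] [v vW Ev] out] := supp i.1.
have start_eq k : (k <= D)%N -> start i - pos i.2 k =
    (if i.2 then k%:Z - (t i.1 + d i.1)%:Z else (t i.1)%:Z - k%:Z).
  by move=> kD; rewrite /start /pos; case: i.2; lia.
split.
- exact: wflag_sub.
- exact: wflag_mono.
- move=> j j_lt0; apply/eqP; rewrite -subv0; apply/subvP => w /wflagP[wW Ew].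
  rewrite memv0; apply/eqP; apply: (@Eb_fullP i.1) => k kD.
  have [kout|kin] := boolP ((k < t i.1)%N || (t i.1 + d i.1 < k)%N).
    exact: out.
  by apply: Ew => //; have := start_eq k kD; case: i.2; lia.
- apply/eqP; rewrite eqEsubv wflag_sub /=; apply/subvP => w wW; apply/wflagP.
  split=> // k kD kd; apply: out => //; have := start_eq k kD.
  by move: kd; case: i.2; lia.
- move=> full.
  pose k := if i.2 then t i.1 else (t i.1 + d i.1)%N.
  have kD : (k <= D)%N by rewrite /k; case: i.2; lia.
  have Ek w : w \in W -> Eb i.1 k *m w = 0.
    rewrite -full => /wflagP[_]; apply => //.
    by have := start_eq k kD; rewrite /k; case: i.2; lia.
  by move: Ek; rewrite /k; case: i.2 => Ek; [apply: Etu|apply: Ev]; apply: Ek.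
- pose k := if i.2 then (t i.1 + d i.1)%N else t i.1.
  have kD : (k <= D)%N by rewrite /k; case: i.2; lia.
  have Ek w : w \in W -> Eb i.1 k *m w \in wflag i 0.
    move=> wW; apply/wflagP; split=> [|l lD]; first exact: sW.
    move=> lk; rewrite Eb_act // ifN //; apply: contraTneq lk => ->.
    by have := start_eq k kD; rewrite /k; case: i.2; lia.
  move=> w0; move: Ek; rewrite w0 /k; case: i.2 => Ek.
    by apply: Ev; apply/eqP; rewrite -memv0; apply: Ek.
  by apply: Etu; apply/eqP; rewrite -memv0; apply: Ek.
Qed.

Lemma wflag_tri i j u :
  u \in wflag i j -> Ab (~~ i.1) *m u \in wflag i (j + 1).
Proof.
move=> /wflagP[uW Eu]; apply/wflagP; split=> [|k kD jk]; first exact: stable_Ab.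
rewrite (Eb_dec i.1 u) !mulmx_sumr big1 // => l _; have lD := ltn_ord l.
have [near|far] := boolP ((k.+1 < l)%N || (l.+1 < k)%N).
  by rewrite !mulmxA Ab_tri ?mul0mx.
rewrite Eu ?mulmx0 //; move: jk far lD; rewrite /pos; case: i.2; lia.
Qed.

Definition wflag_eig (i : bool * bool) (j : int) : C :=
  q ^ (if i.2 then 2 * (start i + j) - D%:Z else D%:Z - 2 * (start i + j)).

Lemma wflag_eigP i j u : u \in wflag i j ->
  Ab i.1 *m u - wflag_eig i j *: u \in wflag i (j - 1).
Proof.
move=> /wflagP[uW Eu]; apply/wflagP; split=> [|k kD jk].
  by apply: memvB; [exact: stable_Ab|exact: memvZ].
rewrite mulmxBr Eb_Ab // -scalemxAr -scalerBl.
have [kj|kj] := eqVneq (pos i.2 k) (start i + j); last first.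
  by rewrite Eu ?scaler0 //; lia.
rewrite (_ : q ^ _ = wflag_eig i j) ?subrr ?scale0r // /wflag_eig -kj.
by congr (_ ^ _); rewrite /pos; case: i.2; lia.
Qed.

End Support.

Section Irreducible.
Variables (W : {vspace 'cV[C]_n}).
Hypothesis irrW : irreducible W.

(** Two flags of the same system are opposite because the components $E_kw$ themselves decompose
    [W]. Two flags of different systems are handled by [split_opp] and [split_dec], with the two
    matrices $A$, $A^*$ tridiagonal on one another's flags. *)
Lemma irreducible_flags : exists (t : bool -> nat) (d : nat),
  (forall b, support W b (t b) d) /\
  opposite_flags W (wflag W t (fun=> d)) d.
Proof.
have [W0 sW minW] := irrW.
have [t0 [d0 s0]] := support_ex false W0; have [t1 [d1 s1]] := support_ex true W0.
pose t b := if b then t1 else t0; pose db b := if b then d1 else d0.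
have supp b : support W b (t b) (db b) by case: b.
have full := wflag_full sW supp.
have minA U : (U <= W)%VS -> (forall u, u \in U -> Ab false *m u \in U) ->
    (forall u, u \in U -> Ab true *m u \in U) -> U = 0%VS \/ U = W.
  by move=> UW U0 U1; apply: minW => //; apply: Ab_stable => -[].
have tri i := @wflag_tri W t db sW i; have eig i := @wflag_eigP W t db sW i.
have dE : d1 = d0.
  apply: (split_diameter (full (true, false)) (full (false, false)) minA).
  - exact: (tri (true, false)).
  - exact: (eig (false, false)).
  - exact: (tri (false, false)).
  - exact: (eig (true, false)).
have opp m m' := split_opp (full (true, m)) (full (false, m')) minA
  (tri (true, m)) (eig (false, m')) (tri (false, m')) (eig (true, m)).
have dec m m' := split_dec (full (true, m)) (full (false, m')) minA
  (tri (true, m)) (eig (false, m')) (tri (false, m')) (eig (true, m)).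
have dbE : db = (fun=> d0) by apply/funext => -[]; rewrite /db.
rewrite {}dbE {dE db s0 s1 d1 minA} /= in supp full tri eig opp dec *.
exists t, d0; split=> //; split.
- by move=> i j; apply: wflag_sub.
- by move=> i j j'; apply: wflag_mono.
- move=> [b m] [b' m'] j j' u ne jj'.
  have [bb'|bb'] := eqVneq b b'.
    move: ne; rewrite -{}bb' xpair_eqE eqxx /= => mm' /wflagP[/= uW Eu] /wflagP[_ /= Eu'].
    have [tdD _ _ out] := supp b.
    apply: (@Eb_fullP b) => k kD.
    have [kj|kj] := ltrP (start t (fun=> d0) (b, m) + j) (pos m k); first exact: Eu.
    apply: Eu' => //; move: mm' kj; rewrite /start /pos /=.
    by case: m {Eu} => /=; case: m' => //= _; lia.
  case: b b' {ne} bb' => [] [] //= _ u1 u2; first exact: opp jj' u1 u2.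
  by rewrite addrC in jj'; exact: opp jj' u2 u1.
- have rev i j w :
      (exists c, flag_decomposition (wflag W t (fun=> d0)) d0 i j c /\
         w = \sum_(l < d0.+1) c l) ->
      (exists c, flag_decomposition (wflag W t (fun=> d0)) d0 j i c /\
         w = \sum_(l < d0.+1) c l).
    move=> [c [cP ->]]; exists (fun l => c (d0 - l)%N); split=> [l ld|].
      have [c1 c0] := cP (d0 - l)%N (leq_subr _ _).
      by rewrite -subzn // in c1 c0 *; rewrite subKr in c0.
    by rewrite (reindex_inj rev_ord_inj) /=; apply: eq_bigr => l _; rewrite subSS.
  have dec_same b w : w \in W -> exists c,
      flag_decomposition (wflag W t (fun=> d0)) d0 (b, false) (b, true) c /\
      w = \sum_(l < d0.+1) c l.
    move=> wW; have [tdD _ _ out] := supp b.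
    exists (fun l => Eb b (t b + l) *m w); split=> [l ld|].
      have lD : (t b + l <= D)%N by lia.
      split; apply/wflagP; split=> [|k kD kl]; try exact: sW.
        rewrite Eb_act // ifN //; apply: contraTneq kl => ->.
        by rewrite /start /pos /=; lia.
      rewrite Eb_act // ifN //; apply: contraTneq kl => ->.
      by rewrite /start /pos /=; lia.
    rewrite {1}(Eb_dec b w) -(big_mkord xpredT (fun k => Eb b k *m w)).
    rewrite (@big_cat_nat _ _ _ (t b)) //=; last by lia.
    rewrite [X in X + _]big_nat big1 ?add0r => [|k /andP[_ kt]]; last first.
      by apply: out => //; [lia | rewrite kt].
    rewrite (@big_cat_nat _ _ _ (t b + d0).+1) //=; last by lia.
    rewrite [X in _ + X]big_nat [X in _ + X]big1 ?addr0 => [|k /andP[kt kD]].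
      rewrite -{1}[t b]add0n big_addn -addnS addKn big_mkord.
      by apply: eq_bigr => k _; rewrite addnC.
    by apply: out => //; rewrite kt orbT.
  move=> [b m] [b' m'] w ne wW.
  have [bb'|bb'] := eqVneq b b'.
    move: ne; rewrite -{}bb' xpair_eqE eqxx /=.
    by case: m m' => [] [] //= _; [apply/rev/dec_same|apply/dec_same].
  by case: b b' {ne} bb' => [] [] //= _; [exact: dec|apply/rev/dec].
Qed.

End Irreducible.

(** * From the split subspaces of V to the flags of W *)

Section Actions.
Variables (W : {vspace 'cV[C]_n}) (t : bool -> nat) (d : nat).
Hypotheses (sW : stable W) (supp : forall b, support W b (t b) d).
Hypothesis oF : opposite_flags W (wflag W t (fun=> d)) d.

Local Notation Fl := (wflag W t (fun=> d)).
Local Notation st := (start t (fun=> d)).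

(* W is orthogonal to W^perp, both are stable, and W meets the split subspace *)
(* trivially because its flags are opposite. *)
Lemma wflag_hdot m m' (k k' : int) u w : k + k' < d%:Z -> u \in W ->
    w \in splitV (Eb true) (Eb false) D (arr m) (arr m')
      (st (true, m) + k) (st (false, m') + k') ->
  hdot u w = 0.
Proof.
move=> kk' uW; rewrite memv_cap => /andP[/flagP w1 /flagP w0].
have [p pW wp] := hdot_orth_proj W w.
have pE b (l : nat) : (l <= D)%N -> Eb b l *m w = 0 -> Eb b l *m p = 0.
  move=> lD Ew; have : Eb b l *m p \in (W :&: hdot_orth W)%VS.
    rewrite memv_cap sW //= -[Eb b l *m p]opprK memvN -[- (_ *m p)]add0r -Ew.
    by rewrite -mulmxBr; apply: stable_hdot_orth.
  by rewrite hdot_orth_cap memv0 => /eqP.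
have p0 : p = 0.
  apply: (flag_opp oF (_ : (true, m) != (false, m')) kk') => //; apply/wflagP.
    by split=> // l lD jl; apply/pE/w1.
  by split=> // l lD jl; apply/pE/w0.
move: wp; rewrite p0 subr0 => /hdot_orthP/(_ u uW) wu.
by rewrite -hdot_conj wu rmorph0.
Qed.

(** Lowering either index brings the sum of the steps below $d$, so [wflag_hdot] gives orthogonality
    to both smaller subspaces. This is what allows matrices defined on all of $V$ to be evaluated on
    [W]. *)
Lemma wflag_splitW m m' (k : int) u :
    u \in Fl (true, m) k -> u \in Fl (false, m') (d%:Z - k) ->
  splitW (Eb true) (Eb false) D (arr m) (arr m')
    (st (true, m) + k) (st (false, m') + (d%:Z - k)) u.
Proof.
move=> u1 u0; have [uW /flagP f1] := iffLR (wflagP _ _ _ _ _ _) u1.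
have [_ /flagP f0] := iffLR (wflagP _ _ _ _ _ _) u0.
split=> [|w /memv_addP[w1 w1V [w2 w2V ->]]]; first by rewrite memv_cap f1 f0.
rewrite hdotDr; rewrite -addrA in w1V; rewrite -addrA in w2V.
rewrite (wflag_hdot _ uW w1V) ?(wflag_hdot _ uW w2V) ?addr0 //; lia.
Qed.

Lemma start_bound b m (k : nat) : (k <= d)%N ->
  exists2 i : nat, st (b, m) + k%:Z = i & (i <= D)%N.
Proof.
move=> kd; have [tdD _ _ _] := supp b; rewrite /start /=.
case: m; [exists (D - (t b + d) + k)%N | exists (t b + k)%N]; lia.
Qed.

Lemma acts_on_wflag m m' M f :
    acts_on_split (Eb true) (Eb false) D (arr m) (arr m') M f ->
  forall (k : int) u, u \in Fl (true, m) k -> u \in Fl (false, m') (d%:Z - k) ->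
  M *m u = f (st (true, m) + k) (st (false, m') + (d%:Z - k)) *: u.
Proof.
move=> Mf k u u1 u0; have uS := wflag_splitW u1 u0.
have full := wflag_full sW supp.
have [k_lt0|k_ge0] := ltrP k 0.
  by move: u1; rewrite (ff_neg (full _)) // memv0 => /eqP->; rewrite mulmx0 scaler0.
have [k_gtd|k_led] := ltrP (d%:Z) k.
  move: u0; rewrite (ff_neg (full _)) ?subr_lt0 // memv0 => /eqP->.
  by rewrite mulmx0 scaler0.
have [i iE iD] := @start_bound true m `|k| ltac:(lia).
have [j jE jD] := @start_bound false m' (d - `|k|) (leq_subr _ _).
have dk : (d - `|k|)%N%:Z = d%:Z - k by lia.
rewrite gez0_abs // in iE; rewrite {}dk in jE; rewrite iE jE in uS *.
exact: Mf.
Qed.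

(** The ascending and the descending flag predict the same eigenvalue; the error is lowered in both
    flags and so vanishes. *)
Lemma Ab_wflag b (k : int) u :
    u \in Fl (b, false) k -> u \in Fl (b, true) (d%:Z - k) ->
  Ab b *m u = q ^ (D%:Z - 2 * ((t b)%:Z + k)) *: u.
Proof.
move=> uf ut; apply/eqP; rewrite -subr_eq0; apply/eqP.
have ne : (b, false) != (b, true) by rewrite xpair_eqE andbF.
have := wflag_eigP sW ut; have := wflag_eigP sW uf; rewrite /wflag_eig /start /=.
rewrite (_ : 2 * _ - D%:Z = D%:Z - 2 * ((t b)%:Z + k)); last by lia.
by move=> uf' ut'; apply: (flag_opp oF ne _ uf' ut'); lia.
Qed.

End Actions.

(** * The generators and their relations *)

Variables (B Bs K Ks Phi Psi : 'M[C]_n).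
Let acts eta mu M f := acts_on_split (Eb true) (Eb false) D eta mu M f.
Hypothesis B_def : acts down up B (fun i j => q ^ (i - j)).
Hypothesis Bs_def : acts up down Bs (fun i j => q ^ (j - i)).
Hypothesis K_def : acts down down K (fun i j => q ^ (i - j)).
Hypothesis Ks_def : acts up up Ks (fun i j => q ^ (i - j)).
Hypothesis Phi_def : acts down down Phi (fun i j => q ^ (i + j - D%:Z)).
Hypothesis Psi_def : acts down up Psi (fun i j => q ^ (i + j - D%:Z)).

(* The value off the six oriented pairs is junk. *)
Definition xgen0 (i j : bool * bool) : 'M[C]_n :=
  match i, j with
  | (false, false), (false, true) => Ab false *m Phi *m invmx Psi
  | (false, true), (true, false) => B *m invmx Phi
  | (true, false), (true, true) => Ab true *m Phi *m Psi
  | (true, true), (false, false) => Bs *m invmx Phi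
  | (false, false), (true, false) => K *m invmx Psi
  | (false, true), (true, true) => Ks *m Psi
  | _, _ => 1%:M
  end.

Definition oriented (i j : bool * bool) : bool :=
  (i, j) \in [:: ((false, false), (false, true)); ((false, true), (true, false));
    ((true, false), (true, true)); ((true, true), (false, false));
    ((false, false), (true, false)); ((false, true), (true, true))].

(** Extending by inverses gives a matrix for each ordered pair of flags, so that [FlagRelations]
    applies uniformly. *)
Definition xgen i j := if oriented i j then xgen0 i j else invmx (xgen0 j i).

Section GeneratorActions.
Variables (W : {vspace 'cV[C]_n}) (t : bool -> nat) (d : nat).
Hypotheses (sW : stable W) (supp : forall b, support W b (t b) d).
Hypothesis oF : opposite_flags W (wflag W t (fun=> d)) d.
Local Notation Fl := (wflag W t (fun=> d)).

(** Along the decomposition of [W] the first index rises and the second falls at the same rate, so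
    $i+j-D$ is constant; the same holds for [Psi_act]. *)
Lemma Phi_act u : u \in W ->
  Phi *m u = q ^ ((t true)%:Z + (t false)%:Z + d%:Z - D%:Z) *: u.
Proof.
move=> /(flag_dec oF (_ : (true, false) != (false, false)))[//|c [dc ->]].
rewrite mulmx_sumr scaler_sumr; apply: eq_bigr => l _.
have [c1 c0] := dc l (leq_ord l).
rewrite (acts_on_wflag (m := false) (m' := false) sW supp oF Phi_def c1 c0) /start /=.
by congr (_ ^ _ *: _); lia.
Qed.

Lemma Psi_act u : u \in W ->
  Psi *m u = q ^ ((t true)%:Z - (t false)%:Z) *: u.
Proof.
move=> /(flag_dec oF (_ : (true, false) != (false, true)))[//|c [dc ->]].
rewrite mulmx_sumr scaler_sumr; apply: eq_bigr => l _.
have [c1 c0] := dc l (leq_ord l).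
rewrite (acts_on_wflag (m := false) (m' := true) sW supp oF Psi_def c1 c0) /start /=.
by congr (_ ^ _ *: _); lia.
Qed.

End GeneratorActions.

Lemma unitmx_irr (M : 'M[C]_n) :
    (forall W, irreducible W -> forall w, w \in W -> exists u, M *m u = w) ->
  M \in unitmx.
Proof.
move=> MW; apply: surj_unitmx; apply: irreducible_ind MW.
  by exists 0; rewrite mulmx0.
by move=> u v [u' <-] [v' <-]; exists (u' + v'); rewrite mulmxDr.
Qed.

Lemma Phi_unit : Phi \in unitmx.
Proof.
apply: unitmx_irr => W irrW w wW; have [_ sW _] := irrW.
have [t [d [supp oF]]] := irreducible_flags irrW.
exists (q ^ (- ((t true)%:Z + (t false)%:Z + d%:Z - D%:Z)) *: w).
by rewrite -scalemxAr (Phi_act sW supp oF wW) scalerA -expfzDr // addNr scale1r.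
Qed.

Lemma Psi_unit : Psi \in unitmx.
Proof.
apply: unitmx_irr => W irrW w wW; have [_ sW _] := irrW.
have [t [d [supp oF]]] := irreducible_flags irrW.
exists (q ^ (- ((t true)%:Z - (t false)%:Z)) *: w).
by rewrite -scalemxAr (Psi_act sW supp oF wW) scalerA -expfzDr // addNr scale1r.
Qed.

Lemma invmx_act (M : 'M[C]_n) u (m : int) : M \in unitmx ->
  M *m u = q ^ m *: u -> invmx M *m u = q ^ (- m) *: u.
Proof.
move=> uM Mu; rewrite -[X in q ^ (- m) *: X](mulKmx uM) Mu -scalemxAr scalerA.
by rewrite -expfzDr // addNr scale1r.
Qed.

Section GeneratorEigen.
Variables (W : {vspace 'cV[C]_n}) (t : bool -> nat) (d : nat).
Hypotheses (sW : stable W) (supp : forall b, support W b (t b) d).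
Hypothesis oF : opposite_flags W (wflag W t (fun=> d)) d.
Local Notation Fl := (wflag W t (fun=> d)).

(** The split subspaces list the $E^*$-flag first. For the generators that leave an $E$-flag towards
    an $E^*$-flag, [acts_on_wflag] is therefore used with [k] replaced by $d-k$. *)
Lemma xgen0_eig i j : oriented i j -> forall (k : int) u,
  u \in Fl i k -> u \in Fl j (d%:Z - k) ->
  xgen0 i j *m u = q ^ (d%:Z - 2 * k) *: u.
Proof.
have mul_scale (M N : 'M[C]_n) u m1 m2 : M *m u = q ^ m1 *: u ->
    N *m u = q ^ m2 *: u -> M *m N *m u = q ^ (m1 + m2) *: u.
  by move=> Mu Nu; rewrite -mulmxA Nu -scalemxAr Mu scalerA -expfzDr // addrC.
move=> ij k u ui uj; have uW := flag_memW oF ui.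
have Pu := Phi_act sW supp oF uW; have Qu := Psi_act sW supp oF uW.
have Pu' := invmx_act Phi_unit Pu; have Qu' := invmx_act Psi_unit Qu.
have dkk : u \in Fl i (d%:Z - (d%:Z - k)) by rewrite subKr.
move: ij ui uj dkk; rewrite /oriented !inE => /or4P[|||/or3P[]];
  move=> /eqP[-> ->] /= ui uj dkk.
- rewrite (mul_scale _ _ _ _ _ (mul_scale _ _ _ _ _ (Ab_wflag sW oF ui uj) Pu) Qu').
  by congr (_ ^ _ *: _); lia.
- have := acts_on_wflag (m := false) (m' := true) sW supp oF B_def uj dkk.
  move=> Mu; rewrite (mul_scale _ _ _ _ _ Mu Pu') /start /=.
  by congr (_ ^ _ *: _); lia.
- rewrite (mul_scale _ _ _ _ _ (mul_scale _ _ _ _ _ (Ab_wflag sW oF ui uj) Pu) Qu).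
  by congr (_ ^ _ *: _); lia.
- have := acts_on_wflag (m := true) (m' := false) sW supp oF Bs_def ui uj.
  move=> Mu; rewrite (mul_scale _ _ _ _ _ Mu Pu') /start /=.
  by congr (_ ^ _ *: _); lia.
- have := acts_on_wflag (m := false) (m' := false) sW supp oF K_def uj dkk.
  move=> Mu; rewrite (mul_scale _ _ _ _ _ Mu Qu') /start /=.
  by congr (_ ^ _ *: _); lia.
- have := acts_on_wflag (m := true) (m' := true) sW supp oF Ks_def uj dkk.
  move=> Mu; rewrite (mul_scale _ _ _ _ _ Mu Qu) /start /=.
  by congr (_ ^ _ *: _); lia.
Qed.

End GeneratorEigen.

Lemma oriented_neq i j : oriented i j -> i != j.
Proof. by case: i j => [[] []] [[] []]. Qed.

Lemma orientedC i j : i != j -> ~~ oriented i j -> oriented j i.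
Proof. by case: i j => [[] []] [[] []]. Qed.

Lemma xgen0_unit i j : oriented i j -> xgen0 i j \in unitmx.
Proof.
move=> oij; apply: unitmx_irr => W irrW w wW; have [_ sW _] := irrW.
have [t [d [supp oF]]] := irreducible_flags irrW.
have [c [dc ->]] := flag_dec oF (oriented_neq oij) wW.
exists (\sum_(l < d.+1) q ^ (- (d%:Z - 2 * l%:Z)) *: c l).
rewrite mulmx_sumr; apply: eq_bigr => l _; have [ci cj] := dc l (leq_ord l).
rewrite -scalemxAr (xgen0_eig sW supp oF oij ci cj) scalerA -expfzDr // addNr.
by rewrite scale1r.
Qed.

Lemma xgen_eig W t d : stable W -> (forall b, support W b (t b) d) ->
    opposite_flags W (wflag W t (fun=> d)) d ->
  forall i j, i != j -> forall (k : int) u,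
  u \in wflag W t (fun=> d) i k -> u \in wflag W t (fun=> d) j (d%:Z - k) ->
  xgen i j *m u = q ^ (d%:Z - 2 * k) *: u.
Proof.
move=> sW supp oF i j ij k u ui uj; rewrite /xgen.
case: ifPn => oij; first exact: (xgen0_eig sW supp oF oij ui uj).
have oji := orientedC ij oij.
have ui' : u \in wflag W t (fun=> d) i (d%:Z - (d%:Z - k)) by rewrite subKr.
have := xgen0_eig sW supp oF oji uj ui'.
move=> /(invmx_act (xgen0_unit oji)) ->; congr (_ ^ _ *: _).
by lia.
Qed.

Lemma xgenV i j : oriented i j -> xgen i j *m xgen j i = 1%:M.
Proof.
move=> oij; rewrite /xgen oij ifN ?mulmxV ?xgen0_unit //.
by move: oij; case: i j => [[] []] [[] []].
Qed.

Lemma mulmx_irr (M N : 'M[C]_n) :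
    (forall W, irreducible W -> forall w, w \in W -> M *m w = N *m w) -> M = N.
Proof.
move=> MN; apply: mulmx_ext; apply: irreducible_ind MN; first by rewrite !mulmx0.
by move=> u v Mu Mv; rewrite !mulmxDr Mu Mv.
Qed.

Local Notation weyl i j k := (qweyl q (xgen i j) (xgen j k)).

(** On [W] this generator is a scalar multiple of $A$ or $A^*$, hence tridiagonal on the flags of
    the other system. *)
Lemma xgen_diag_tri W t d b m : stable W -> (forall b, support W b (t b) d) ->
    opposite_flags W (wflag W t (fun=> d)) d ->
  forall (k : int) u, u \in wflag W t (fun=> d) (~~ b, m) k ->
  xgen (b, false) (b, true) *m u \in wflag W t (fun=> d) (~~ b, m) (k + 1).
Proof.
move=> sW supp oF k u uF; have uW := flag_memW oF uF.
have := wflag_tri sW uF; rewrite /= negbK => AF.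
have Pu := Phi_act sW supp oF uW; have Qu := Psi_act sW supp oF uW.
have Qu' := invmx_act Psi_unit Qu; rewrite /xgen.
case: b {uF} AF => /= AF; rewrite -!mulmxA ?Qu ?Qu' -scalemxAr Pu -!scalemxAr.
  by do 2!apply: memvZ.
by do 2!apply: memvZ.
Qed.

Lemma xgen_weyl_l b m : weyl (~~ b, m) (b, false) (b, true).
Proof.
apply: mulmx_irr => W irrW w wW; have [_ sW _] := irrW.
have [t [d [supp oF]]] := irreducible_flags irrW.
rewrite mul_scalar_mx.
apply: (weyl_on_l q_neq0 oF (xgen_eig sW supp oF)) => //; try by case: (b).
exact: xgen_diag_tri.
Qed.

Lemma xgen_weyl_r b m : weyl (b, false) (b, true) (~~ b, m).
Proof.
apply: mulmx_irr => W irrW w wW; have [_ sW _] := irrW.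
have [t [d [supp oF]]] := irreducible_flags irrW.
rewrite mul_scalar_mx.
apply: (weyl_on_r q_neq0 oF (xgen_eig sW supp oF)) => //; try by case: (b).
exact: xgen_diag_tri.
Qed.

(** The two other rotations of this triple contain the arrow carried by $A$ or $A^*$, and they are
    the hypotheses of [weyl_on_cyclic]. *)
Lemma xgen_weyl_c b m : weyl (b, true) (~~ b, m) (b, false).
Proof.
apply: mulmx_irr => W irrW w wW; have [_ sW _] := irrW.
have [t [d [supp oF]]] := irreducible_flags irrW.
rewrite mul_scalar_mx.
apply: (weyl_on_cyclic q_neq0 q_nroot oF (xgen_eig sW supp oF)) => //;
  try by case: (b).
  exact: xgen_weyl_l.
exact: xgen_weyl_r.
Qed.

Lemma xgen_serre i j k l : i != j -> j != k -> k != l -> l != i ->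
    weyl i j k -> weyl j k l -> weyl k l i -> weyl l i j ->
  qserre q (xgen i j) (xgen k l) = 0.
Proof.
move=> ij jk kl li w1 w2 w3 w4.
apply: mulmx_irr => W irrW w wW; have [_ sW _] := irrW.
have [t [d [supp oF]]] := irreducible_flags irrW.
rewrite mul0mx.
exact: (qserre_on q_neq0 q_nroot oF (xgen_eig sW supp oF) ij jk li).
Qed.

(** Vertices 0 and 1 are the two $E$-flags and vertices 2 and 3 the two $E^*$-flags, ascending
    before descending. *)
Definition flag_of (i : 'Z_4) : bool * bool := (1 < i, odd i)%N.

Lemma terwilliger_qtet : exists act : qtet q -> 'cV[C]_n -> 'cV[C]_n,
  qalg_module act /\
  forall v,
    [/\ act (qtet_gen q 0 1) v = Ab false *m Phi *m invmx Psi *m v,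
        act (qtet_gen q 1 2) v = B *m invmx Phi *m v
      & act (qtet_gen q 2 3) v = Ab true *m Phi *m Psi *m v] /\
    [/\ act (qtet_gen q 3 0) v = Bs *m invmx Phi *m v,
        act (qtet_gen q 0 2) v = K *m invmx Psi *m v
      & act (qtet_gen q 1 3) v = Ks *m Psi *m v].
Proof.
have shift (i j k : 'Z_4) : j - i = k -> j = i + k by move=> <-; rewrite addrC subrK.
have [|||act [actM actE]] :=
    @qtet_module_ex C q n (fun i j => xgen (flag_of i) (flag_of j)).
- move=> i j /shift ->; case: i => [[|[|[|[|//]]]] ?].
  + exact: (@xgenV (false, false) (true, false)).
  + exact: (@xgenV (false, true) (true, true)).
  + exact: mulmx1C (@xgenV (false, false) (true, false) isT).
  + exact: mulmx1C (@xgenV (false, true) (true, true) isT).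
- move=> h i j e; have q2 : q - q^-1 != 0.
    rewrite subr_eq0; apply/eqP => qq; have : q ^ (2 : int) = 1.
      by rewrite -exprnP expr2 {2}qq divff.
    by move/q_nroot.
  have scal (M N : 'M[C]_n) : qweyl q M N ->
      (q - q^-1)^-1 *: (q *: (M *m N) - q^-1 *: (N *m M)) = 1%:M.
    by move=> ->; rewrite scale_scalar_mx mulVf.
  apply: scal; move: e; rewrite !inE !xpair_eqE.
  case/or3P=> /andP[/eqP/shift -> /eqP/shift ->]; case: h => [[|[|[|[|//]]]] ?].
  + exact: (xgen_weyl_r false false).
  + exact: (xgen_weyl_l true true).
  + exact: (xgen_weyl_r true false).
  + exact: (xgen_weyl_l false true).
  + exact: (xgen_weyl_r false true).
  + exact: (xgen_weyl_c false false).
  + exact: (xgen_weyl_r true true).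
  + exact: (xgen_weyl_c true false).
  + exact: (xgen_weyl_l true false).
  + exact: (xgen_weyl_c false true).
  + exact: (xgen_weyl_l false false).
  + exact: (xgen_weyl_c true true).
- move=> h i j k /shift -> /shift -> /shift ->; case: h => [[|[|[|[|//]]]] ?].
  + apply: (@xgen_serre (false, false) (false, true) (true, false) (true, true)) => //.
    * exact: (xgen_weyl_r false false).
    * exact: (xgen_weyl_l true true).
    * exact: (xgen_weyl_r true false).
    * exact: (xgen_weyl_l false true).
  + apply: (@xgen_serre (false, true) (true, false) (true, true) (false, false)) => //.
    * exact: (xgen_weyl_l true true).
    * exact: (xgen_weyl_r true false).
    * exact: (xgen_weyl_l false true).
    * exact: (xgen_weyl_r false false).
  + apply: (@xgen_serre (true, false) (true, true) (false, false) (false, true)) => //.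
    * exact: (xgen_weyl_r true false).
    * exact: (xgen_weyl_l false true).
    * exact: (xgen_weyl_r false false).
    * exact: (xgen_weyl_l true true).
  + apply: (@xgen_serre (true, true) (false, false) (false, true) (true, false)) => //.
    * exact: (xgen_weyl_l false true).
    * exact: (xgen_weyl_r false false).
    * exact: (xgen_weyl_l true true).
    * exact: (xgen_weyl_r true false).
by exists act; split=> // v; rewrite !actE.
Qed.

End TerwilligerModules.

(** * Distance-regular graphs *)

Section GraphDistance.
Variables (X : finType) (e : rel X).
Hypotheses (simple_e : simple_graph e) (conn_e : connected_graph e).
Local Notation dist := (gdist e).
Implicit Types (w y z : X) (p : seq X).

Lemma gdist_path y z :
  exists p, [/\ path e y p, last y p = z & size p = dist y z].
Proof.
have /connectP[p0 p0P zE] := conn_e y z.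
have [p [pP pz pX]] : exists p, [/\ path e y p, last y p = z & (size p < #|X|)%N].
  rewrite zE; case/shortenP: p0P => p pP py _; exists p; split=> //.
  by rewrite -[(_ < _)%N]/(size (y :: p) <= _)%N -(card_uniqP py) max_card.
have has_z : has (fun n => [exists p : n.-tuple X, path e y p && (last y p == z)])
    (iota 0 #|X|).
  apply/hasP; exists (size p); first by rewrite mem_iota.
  by apply/existsP; exists (in_tuple p); rewrite pP pz eqxx.
have := nth_find 0%N has_z; rewrite has_find size_iota in has_z.
rewrite nth_iota // add0n => /existsP[r /andP[rP /eqP rz]].
by exists r; rewrite size_tuple.
Qed.

Lemma gdist_le y z p : path e y p -> last y p = z -> (dist y z <= size p)%N.
Proof.
move=> pP pz; have [pX|] := ltnP (size p) #|X|; last first.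
  by apply: leq_trans; rewrite -[X in (_ <= X)%N](size_iota 0) find_size.
rewrite leqNgt; apply/negP => lt; have := before_find 0%N lt.
rewrite nth_iota // add0n /= => /existsP; apply.
by  exists (in_tuple p); rewrite pP pz eqxx.
Qed.

Lemma gdist_tri y w z : (dist y z <= dist y w + dist w z)%N.
Proof.
have [p [pP pw <-]] := gdist_path y w; have [r [rP rz <-]] := gdist_path w z.
by rewrite -size_cat; apply: gdist_le; rewrite ?cat_path ?last_cat pw ?pP.
Qed.

Lemma gdistC y z : dist y z = dist z y.
Proof.
suff le y' z' : (dist y' z' <= dist z' y')%N by apply/eqP; rewrite eqn_leq !le.
have [p [pP pw <-]] := gdist_path z' y'.
rewrite -(size_belast z') -size_rev; apply: gdist_le.
  rewrite -pw rev_path; apply: sub_path pP => u v.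
  by rewrite (simple_e.1 u).
by rewrite -pw; case: (p) => //= a r; rewrite rev_cons last_rcons.
Qed.

Lemma gdistxx y : dist y y = 0%N.
Proof. by apply/eqP; rewrite -leqn0; apply: (@gdist_le y y [::]). Qed.

Lemma gdist_eq0 y z : dist y z = 0%N -> y = z.
Proof. by have [[|a p] [_ /= pz <-]] := gdist_path y z. Qed.

Lemma gdist_diameter y z : (dist y z <= diameter e)%N.
Proof.
apply: leq_trans (leq_bigmax y).
exact: (leq_bigmax (F := fun z => dist y z) z).
Qed.

Lemma pnum1_far h j : (h.+1 < j)%N || (j.+1 < h)%N -> pnum e 1 h j = 0%N.
Proof.
rewrite /pnum; case: pickP => // -[y z] /= /eqP yz far.
apply/eqP; rewrite cards_eq0; apply/eqP/setP => w; rewrite !inE.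
apply/negP => /andP[/eqP hE /eqP jE].
have := gdist_tri y z w; have := gdist_tri w y z.
by rewrite (gdistC w y) (gdistC z w) yz hE jE; lia.
Qed.

(** Since $c_2=b(b+1)$, this excludes $b=0$ and $b=-1$. A geodesic of length at least two yields a
    pair at distance two, and a middle vertex is counted by $c_2$. *)
Lemma cnum2_neq0 : (2 <= diameter e)%N -> cnum e 2 <> 0%N.
Proof.
move=> D2; have [y [z yz]] : exists y z, dist y z = 2.
  have X0 : (0 < #|X|)%N.
    rewrite lt0n; apply: contraTneq D2 => X0; rewrite /diameter big_pred0 // => y.
    by have := card0_eq X0 y.
  have [y yE] := @bigop.eq_bigmax X (fun y => \max_z dist y z) X0.
  have [z zE] := @bigop.eq_bigmax X (dist y) X0.
  have yz : dist y z = diameter e by rewrite -zE -yE.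
  have [[|a [|c p]] [pP pz ps]] := gdist_path y z; try by rewrite -yz -ps in D2.
  exists y, c; move: pP => /= /and3P[ya ac cp].
  have l1 : (dist y c <= 2)%N by apply: (@gdist_le y c [:: a; c]); rewrite //= ya ac.
  have l2 : (dist c z <= size p)%N by apply: gdist_le.
  have := gdist_tri y c z; rewrite -ps /=; lia.
have mid y' z' : dist y' z' = 2 -> exists w, dist y' w = 1 /\ dist w z' = 1.
  move=> yz'; have [[|a [|c [|? ?]]] [pP /= cz ps]] := gdist_path y' z';
    rewrite yz' in ps => //.
  move: pP; rewrite /= cz => /and3P[ya az _].
  have l1 : (dist y' a <= 1)%N by apply: (@gdist_le y' a [:: a]); rewrite //= ya.
  have l2 : (dist a z' <= 1)%N by apply: (@gdist_le a z' [:: z']); rewrite //= az.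
  by have := gdist_tri y' a z'; exists a; lia.
rewrite /cnum /pnum; case: pickP => [[y' z'] /= /eqP yz'|/(_ (y, z))/=]; last first.
  by rewrite yz eqxx.
have [w [yw wz]] := mid _ _ yz'.
by move/eqP; rewrite cards_eq0 => /eqP/setP/(_ w); rewrite !inE yw wz eqxx.
Qed.

End GraphDistance.

(** * The parameter q is not a root of unity *)

Section ClassicalParameters.
Variables (C : numClosedFieldType) (b q : C) (c2 c3 : nat).
Hypotheses (b_neq1 : b != 1) (q_b : b = q ^+ 2) (c2_neq0 : c2 <> 0%N).
Hypothesis c2E : c2%:R = b ^ (2%:Z - 1) * ((b ^+ 2 - 1) / (b - 1)).
Hypothesis c3E : c3%:R = b ^ (3%:Z - 1) * ((b ^+ 3 - 1) / (b - 1)).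

(* c_2 = b^2 + b and c_3 = b^4 + b^3 + b^2 force b to be rational. *)
Lemma classical_b_real : b \is Num.real.
Proof.
have b1 : b - 1 != 0 by rewrite subr_eq0.
have e2 : c2%:R = b ^+ 2 + b :> C.
  by rewrite c2E -[b ^ _]/(b ^+ 1); field.
have e3 : c3%:R = b ^+ 4 + b ^+ 3 + b ^+ 2 :> C.
  by rewrite c3E -[b ^ _]/(b ^+ 2); field.
have c20 : c2%:R + 1 != 0 :> C by rewrite natr1 pnatr_eq0.
have -> : b = (c2%:R ^+ 2 + c2%:R - c3%:R) / (c2%:R + 1).
  by apply: (mulIf c20); rewrite mulfVK // e2 e3; ring.
by rewrite !(rpredM, rpredD, rpredN, rpredX, rpredV, rpred1, rpred_nat).
Qed.

Lemma classical_b_neq0 : b != 0.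
Proof.
by apply: contra_notN c2_neq0 => /eqP b0; move: c2E; rewrite b0 mul0r => /eqP;
  rewrite pnatr_eq0 => /eqP.
Qed.

Lemma classical_q_neq0 : q != 0.
Proof.
by apply: contraTneq classical_b_neq0 => q0; rewrite negbK q_b q0 expr0n.
Qed.

(** A real root of unity satisfies $b^2=1$, and then the formula for $c_2$ gives zero. *)
Lemma classical_b_nroot (k : nat) : b ^+ k = 1 -> k = 0%N.
Proof.
case: k => // k bk; have nb : `|b| = 1.
  apply/eqP; rewrite -(@pexpr_eq1 _ _ k.+1) ?normr_ge0 //.
  by rewrite -normrX bk normr1.
have b2 : b ^+ 2 = 1 by rewrite -(real_normK classical_b_real) nb expr1n.
case: c2_neq0; apply/eqP; rewrite -(pnatr_eq0 C) c2E b2 subrr mul0r.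
by rewrite mulr0.
Qed.

Lemma classical_q_nroot (m : int) : q ^ m = 1 -> m = 0.
Proof.
have nat_case k : q ^+ k = 1 -> k = 0%N.
  by move=> qk; apply: classical_b_nroot; rewrite q_b exprAC qk expr1n.
case: m => k; first by move=> /nat_case->.
by rewrite NegzE -invr_expz => /(congr1 GRing.inv); rewrite invrK invr1 => /nat_case.
Qed.

End ClassicalParameters.

Lemma span_map (F : fieldType) (vT : vectType F) (I : eqType) (f : I -> vT)
    (s : seq I) v : uniq s -> v \in <<[seq f i | i <- s]>>%VS ->
  exists c : I -> F, v = \sum_(i <- s) c i *: f i.
Proof.
elim: s v => [|i s IH] v /=.
  by rewrite span_nil memv0 => _ /eqP->; exists (fun=> 0); rewrite big_nil.
move=> /andP[is_ us]; rewrite span_cons => /memv_addP[_ /vlineP[a ->] [w ws ->]].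
have [c ->] := IH _ us ws; exists (fun j => if j == i then a else c j).
rewrite big_cons eqxx; congr (_ + _); rewrite !big_seq.
by apply: eq_bigr => j js; rewrite ifN //; apply: contraNneq is_ => <-.
Qed.

Section MatrixFacts.
Variables (C : numClosedFieldType) (n : nat).
Implicit Types M N P Q : 'M[C]_n.

Lemma mxtrace_adjoint_eq0 M : \tr (M *m map_mx Num.conj M^T) = 0 -> M = 0.
Proof.
have ge0 i j : 0 <= M i j * (M i j)^* by exact: mul_conjC_ge0.
move=> tr0; apply/matrixP => i j; rewrite mxE.
have /eqP : \sum_i \sum_j M i j * (M i j)^* = 0.
  rewrite -[RHS]tr0 /mxtrace; apply: eq_bigr => k _; rewrite mxE.
  by apply: eq_bigr => l _; rewrite !mxE.
rewrite psumr_eq0 => [/allP/(_ i (mem_index_enum _))/=|k _]; last exact: sumr_ge0.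
rewrite psumr_eq0 // => /allP/(_ j (mem_index_enum _))/=.
by rewrite mul_conjC_eq0 => /eqP.
Qed.

Lemma affine_eig (a0 a1 c : C) M N P : a1 != 0 -> M = a0%:M + a1 *: N ->
  M *m P = (a0 + a1 * c) *: P -> N *m P = c *: P.
Proof.
move=> a1n0 ->; rewrite mulmxDl mul_scalar_mx scalerDl => /addrI.
by rewrite -scalemxAl -scalerA => /(scalerI a1n0).
Qed.

Lemma affine_sandwich (a0 a1 : C) M N P Q : a1 != 0 -> M = a0%:M + a1 *: N ->
  P *m Q = 0 -> P *m M *m Q = 0 -> P *m N *m Q = 0.
Proof.
move=> a1n0 -> PQ; rewrite mulmxDr mulmxDl mul_mx_scalar -scalemxAl PQ.
by rewrite scaler0 add0r -scalemxAr -scalemxAl => /eqP; rewrite scaler_eq0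
  (negPf a1n0) => /eqP.
Qed.

Lemma acts_as_image M P c : acts_as M (fun v => v \in mx_image P) c ->
  M *m P = c *: P.
Proof.
move=> MP; apply: mulmx_ext => v; rewrite -mulmxA -scalemxAl MP //.
by apply/mx_imageP; exists v.
Qed.

End MatrixFacts.

(** * Primitive and dual idempotents *)

Section BoseMesner.
Variables (C : numClosedFieldType) (X : finType) (e : rel X).
Hypotheses (simple_e : simple_graph e) (conn_e : connected_graph e).
Local Notation D := (diameter e).
Local Notation n := #|X|.
Local Notation A1 := (distance_mx C e 1).

Lemma distance_mx_tr i : (distance_mx C e i)^T = distance_mx C e i.
Proof.
by apply/matrixP => y z; rewrite !mxE (gdistC simple_e conn_e).
Qed.

Lemma distance_mx_conj i :
  map_mx Num.conj (distance_mx C e i) = distance_mx C e i.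
Proof. by apply/matrixP => y z; rewrite !mxE /= conjC_nat. Qed.

Lemma distance_mx0 : distance_mx C e 0 = 1%:M.
Proof.
apply/matrixP => y z; rewrite !mxE; congr (_%:R : C); congr nat_of_bool.
apply/eqP/eqP => [/(gdist_eq0 conn_e)/enum_val_inj //|->].
exact: gdistxx.
Qed.

Lemma bose_mesner_tr M : M \in bose_mesner C e -> M^T = M.
Proof.
move=> /(span_map (iota_uniq _ _))[c ->]; rewrite linear_sum /=.
by apply: eq_bigr => i _; rewrite linearZ /= distance_mx_tr.
Qed.

Lemma bose_mesner1 : 1%:M \in bose_mesner C e.
Proof.
rewrite -distance_mx0; apply: memv_span; apply: map_f.
by rewrite mem_iota.
Qed.

Variables (E : nat -> 'M[C]_n) (theta : nat -> C).
Hypothesis prim_E : primitive_idempotents e E.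
Hypothesis theta_E : forall i : nat, (i <= D)%N -> A1 *m E i = theta i *: E i.
Hypothesis theta_inj : forall i j : nat, (i <= D)%N -> (j <= D)%N ->
  theta i = theta j -> i = j.

Lemma prim_tr i : (i <= D)%N -> (E i)^T = E i.
Proof. by move=> iD; case: (prim_E.1 i iD) => /bose_mesner_tr. Qed.

Lemma prim_mul i j : (i <= D)%N -> (j <= D)%N ->
  E i *m E j = if i == j then E i else 0.
Proof.
move=> iD jD; have [<-|ij] := eqVneq; first by case: (prim_E.1 i iD).
have EA : E i *m A1 = theta i *: E i.
  by apply: trmx_inj; rewrite trmx_mul linearZ /= prim_tr // distance_mx_tr theta_E.
have : (theta i - theta j) *: (E i *m E j) = 0.
  by rewrite scalerBl scalemxAl -EA -mulmxA theta_E // -scalemxAr subrr.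
move/eqP; rewrite scaler_eq0 subr_eq0 => /orP[/eqP/theta_inj eij|/eqP //].
by move: ij; rewrite eij ?eqxx.
Qed.

Lemma prim_sum : \sum_(k < D.+1) E k = 1%:M.
Proof.
have /andP[/eqP EM _] := prim_E.2.
have := bose_mesner1; rewrite -EM => /(span_map (iota_uniq _ _))[c].
rewrite -[iota _ _]/(index_iota 0 D.+1) big_mkord => one.
rewrite [RHS]one; apply: eq_bigr => k _; have kD := leq_ord k.
(* Multiplying the expansion of the identity by $E_k$ isolates its coefficient. *)
have : (1 - c k) *: E k = 0.
  rewrite scalerBl scale1r -{1}[E k]mulmx1 one mulmx_sumr (bigD1 k) //=.
  rewrite -scalemxAr prim_mul // eqxx big1 ?addr0 ?subrr // => l lk.
  rewrite -scalemxAr prim_mul ?leq_ord // ifN ?scaler0 // eq_sym.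
  by apply: contra lk => /eqP/val_inj->.
have [_ Ek0 _ _] := prim_E.1 k kD.
move/eqP; rewrite scaler_eq0 (negPf Ek0) orbF subr_eq0 => /eqP <-.
by rewrite scale1r.
Qed.

(** Elements of the Bose-Mesner algebra are symmetric, but with complex coefficients this does not
    make them Hermitian. Orthogonality comes instead from $A_1$ being self-adjoint with distinct
    real eigenvalues; that the $E_i$ are Hermitian and real follows. *)
Lemma prim_orth i j u v : (i <= D)%N -> (j <= D)%N -> i != j ->
  hdot (E i *m u) (E j *m v) = 0.
Proof.
have A_self y z : hdot (A1 *m y) z = hdot y (A1 *m z).
  by rewrite hdot_mulmx distance_mx_tr distance_mx_conj.
have move_theta k l y z : (k <= D)%N -> (l <= D)%N ->
    theta k * hdot (E k *m y) (E l *m z) =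
    (theta l)^* * hdot (E k *m y) (E l *m z).
  move=> kD lD; rewrite -hdotZl -hdotZr !scalemxAl -!theta_E // -!mulmxA.
  exact: A_self.
have theta_real k : (k <= D)%N -> (theta k)^* = theta k.
  move=> kD; have [_ /eqP Ek0 _ _] := prim_E.1 k kD.
  have [w Ew] : exists w : 'cV_n, E k *m w <> 0.
    apply: contrapT => /forallNP Ew; apply: Ek0; apply: mulmx_ext => w.
    by rewrite mul0mx; apply: contrapT.
  have := move_theta k k w w kD kD.
  by move/mulIf => <- //; apply/eqP => /hdot_eq0.
move=> iD jD ij; have /eqP := move_theta i j u v iD jD.
rewrite theta_real // -subr_eq0 -mulrBl mulf_eq0 subr_eq0.
by case/orP => /eqP // /theta_inj eij; move: ij; rewrite eij ?eqxx.
Qed.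

Lemma prim_herm k u v : (k <= D)%N -> hdot (E k *m u) v = hdot u (E k *m v).
Proof.
have half y z : (k <= D)%N -> hdot (E k *m y) z = hdot (E k *m y) (E k *m z).
  move=> kD; have kD1 : (k < D.+1)%N by [].
  rewrite -{1}[z]mul1mx -prim_sum mulmx_suml hdot_sumr (bigD1 (Ordinal kD1)) //=.
  rewrite big1 ?addr0 // => l lk; apply: prim_orth; rewrite ?leq_ord //.
  by apply: contra lk => /eqP kl; apply/eqP/val_inj; rewrite /= kl.
by move=> kD; rewrite (half u v kD) -[RHS]hdot_conj (half v u kD) hdot_conj.
Qed.

Lemma prim_conj k : (k <= D)%N -> map_mx Num.conj (E k) = E k.
Proof.
move=> kD; apply: hdot_ext => u v; rewrite -prim_herm // hdot_mulmx.
by rewrite prim_tr.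
Qed.

Variables (x : X) (kr : nat -> nat -> nat -> C).
Hypothesis kr_E : krein_parameters e E kr.
Local Notation As1 := (dual_adjacency E x).

(* The squared Frobenius norm of E_h A*_1 E_j is |X| q^1_{hj} (E_1)_{xx}. *)
Lemma prim_dual_tri h j :
  (0 < D)%N -> (h <= D)%N -> (j <= D)%N -> kr 1%N h j = 0 ->
  E h *m As1 *m E j = 0.
Proof.
move=> D_gt0 hD jD kr0; apply: mxtrace_adjoint_eq0.
pose a : 'rV[C]_n := \row_y (n%:R * E 1%N (enum_rank x) y).
have aE : As1 = diag_mx a by [].
have a_conj : map_mx Num.conj As1 = As1.
  rewrite aE map_diag_mx; congr diag_mx; apply/rowP => y; rewrite !mxE /=.
  rewrite rmorphM /= conjC_nat; congr (_ * _).
  by have /matrixP/(_ (enum_rank x) y) := prim_conj D_gt0; rewrite mxE.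
have -> : map_mx Num.conj (E h *m As1 *m E j)^T = E j *m As1 *m E h.
  rewrite !trmx_mul !prim_tr // {1}aE tr_diag_mx -aE !map_mxM a_conj.
  by rewrite !prim_conj // mulmxA.
rewrite !mulmxA mxtrace_mulC !mulmxA prim_mul // eqxx.
rewrite -(mulmxA (E h *m As1)) prim_mul // eqxx.
pose H := hadamard (E h) (E j).
have HE : E 1%N *m H *m E 1%N = 0.
  rewrite /H kr_E // -scalemxAr -scalemxAl mulmx_sumr mulmx_suml big1 ?scaler0 //.
  move=> l _; rewrite -scalemxAr -scalemxAl prim_mul ?leq_ord //.
  by case: eqP => [<-|_]; rewrite ?mul0mx ?scaler0 // kr0 scale0r.
(* Both sides expand to a sum over $y,z$: the diagonal entries of $A_1^*$ are entries of row [x] of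
   $E_1$, and the entries of $E_h$ and $E_j$ at $(y,z)$ combine into [H]. *)
have -> : \tr (E h *m As1 *m E j *m As1) =
    n%:R ^+ 2 * (E 1%N *m H *m E 1%N) (enum_rank x) (enum_rank x).
  have E1C y z : E 1%N y z = E 1%N z y by rewrite -{1}(prim_tr D_gt0) mxE.
  have EhC y z : E h y z = E h z y by rewrite -{1}(prim_tr hD) mxE.
  rewrite aE /mxtrace [X in _ = _ * X]mxE mulr_sumr; apply: eq_bigr => y _.
  rewrite !mul_mx_diag !mxE !mulr_suml mulr_sumr; apply: eq_bigr => z _.
  by rewrite !mxE (EhC y z) (E1C y); ring.
by rewrite HE mxE mulr0.
Qed.

Lemma dual_idempotent_sum : \sum_(k < D.+1) dual_idempotent C e x k = 1%:M.
Proof.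
apply/matrixP => y z; rewrite summxE [RHS]mxE.
have dD := gdist_diameter e x (enum_val y).
under eq_bigr do rewrite !mxE.
have [_|_] := eqVneq y z; last by rewrite big1.
have dD1 : (gdist e x (enum_val y) < D.+1)%N by [].
rewrite (bigD1 (Ordinal dD1)) //= eqxx big1 ?addr0 // => k kd.
by case: eqP => // kE; case/eqP: kd; exact: val_inj.
Qed.

Lemma dual_idempotent_mul k l :
  dual_idempotent C e x k *m dual_idempotent C e x l =
  if k == l then dual_idempotent C e x k else 0.
Proof.
rewrite mulmx_diag; have [<-|kl] := eqVneq.
  by congr diag_mx; apply/rowP => y; rewrite !mxE -natrM mulnb andbb.
rewrite -(raddf0 (@diag_mx C n)); congr diag_mx; apply/rowP => y; rewrite !mxE.
by rewrite -natrM mulnb; case: eqP => // ->; rewrite (negPf kl).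
Qed.

Lemma dual_idempotent_herm k u v :
  hdot (dual_idempotent C e x k *m u) v = hdot u (dual_idempotent C e x k *m v).
Proof.
rewrite hdot_mulmx tr_diag_mx; have -> // : map_mx Num.conj
  (dual_idempotent C e x k) = dual_idempotent C e x k.
by apply/matrixP => y z; rewrite !mxE rmorphMn /= conjC_nat.
Qed.

Lemma dual_idempotent_tri k l : (k.+1 < l)%N || (l.+1 < k)%N ->
  dual_idempotent C e x k *m A1 *m dual_idempotent C e x l = 0.
Proof.
move=> far; rewrite mul_mx_diag mul_diag_mx; apply/matrixP => y z; rewrite !mxE.
rewrite -!natrM !mulnb; case: eqP => //= yk; case: eqP => //= yz.
case: eqP => //= zl; have := gdist_tri conn_e x (enum_val y) (enum_val z).
have := gdist_tri conn_e x (enum_val z) (enum_val y).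
by rewrite (gdistC simple_e conn_e (enum_val z)) yk yz zl; lia.
Qed.

End BoseMesner.

Theorem theorem11p1 (R : realType) (X : finType) (e : rel X) (D : nat)
    (b beta q : R[i])
    (simple_e : simple_graph e)
    (conn_e : connected_graph e)
    (diam_e : diameter e = D)
    (D_ge3 : (3 <= D)%N)
    (dr_e : distance_regular e)
    (b_neq1 : b != 1)
    (class_e : classical_parameters_b1 e D b beta)
    (q_b : b = q ^+ 2)
    (E : nat -> 'M[R[i]]_#|X|)
    (prim_E : primitive_idempotents e E)
    (kr : nat -> nat -> nat -> R[i])
    (kr_E : krein_parameters e E kr)
    (self_dual : forall h i j, (h <= D)%N -> (i <= D)%N -> (j <= D)%N ->
       kr h i j = (pnum e h i j)%:R)
    (theta : nat -> R[i])
    (theta_E : forall i, (i <= D)%N ->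
       acts_as (distance_mx _ e 1) (fun v => v \in mx_image (E i)) (theta i))
    (x : X)
    (thetas : nat -> R[i])
    (thetas_Es : forall i, (i <= D)%N ->
       acts_as (dual_adjacency E x)
         (fun v => v \in mx_image (dual_idempotent _ e x i)) (thetas i))
    (alpha0 alpha1 : R[i])
    (alpha1_neq0 : alpha1 != 0)
    (theta_eq : forall i : nat, (i <= D)%N ->
       theta i = alpha0 + alpha1 * q ^ (D%:Z - 2 * i%:Z))
    (thetas_eq : forall i : nat, (i <= D)%N ->
       thetas i = alpha0 + alpha1 * q ^ (D%:Z - 2 * i%:Z))
    (A As B Bs K Ks Phi Psi : 'M[R[i]]_#|X|)
    (A_def : distance_mx _ e 1 = alpha0%:M + alpha1 *: A)
    (As_def : dual_adjacency E x = alpha0%:M + alpha1 *: As)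
    (B_def : acts_on_split (dual_idempotent _ e x) E D down up B
       (fun i j => q ^ (i - j)))
    (Bs_def : acts_on_split (dual_idempotent _ e x) E D up down Bs
       (fun i j => q ^ (j - i)))
    (K_def : acts_on_split (dual_idempotent _ e x) E D down down K
       (fun i j => q ^ (i - j)))
    (Ks_def : acts_on_split (dual_idempotent _ e x) E D up up Ks
       (fun i j => q ^ (i - j)))
    (Phi_def : acts_on_split (dual_idempotent _ e x) E D down down Phi
       (fun i j => q ^ (i + j - D%:Z)))
    (Psi_def : acts_on_split (dual_idempotent _ e x) E D down up Psi
       (fun i j => q ^ (i + j - D%:Z))) :
  exists act : qtet q -> 'cV[R[i]]_#|X| -> 'cV[R[i]]_#|X|,
    qalg_module act /\
    forall v,
      [/\ act (qtet_gen q 0 1) v = A *m Phi *m invmx Psi *m v,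
          act (qtet_gen q 1 2) v = B *m invmx Phi *m v
        & act (qtet_gen q 2 3) v = As *m Phi *m Psi *m v] /\
      [/\ act (qtet_gen q 3 0) v = Bs *m invmx Phi *m v,
          act (qtet_gen q 0 2) v = K *m invmx Psi *m v
        & act (qtet_gen q 1 3) v = Ks *m Psi *m v].

Proof.
move: diam_e D_ge3 class_e self_dual theta_E thetas_Es theta_eq thetas_eq
  B_def Bs_def K_def Ks_def Phi_def Psi_def => <- {D} D3 cls sd thE thsE th_eq
  ths_eq B_def Bs_def K_def Ks_def Phi_def Psi_def.
have [c2E _] := cls 2 (ltnW D3); have [c3E _] := cls 3 D3.
have c2 := cnum2_neq0 conn_e (ltnW D3).
have q0 := classical_q_neq0 q_b c2 c2E.
have qn := classical_q_nroot b_neq1 q_b c2 c2E c3E.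
have A1E i : (i <= diameter e)%N ->
    distance_mx _ e 1 *m E i = theta i *: E i.
  by move=> iD; apply: acts_as_image; apply: thE.
have th_inj i j : (i <= diameter e)%N -> (j <= diameter e)%N ->
    theta i = theta j -> i = j.
  move=> iD jD; rewrite !th_eq // => /addrI/(mulfI alpha1_neq0).
  by move/(exprz_inj q0 qn); lia.
pose Eb (c : bool) := if c then dual_idempotent R[i] e x else E.
pose Ab (c : bool) := if c then As else A.
apply: (@terwilliger_qtet _ _ (diameter e) q q0 qn Eb Ab).
- case; first exact: dual_idempotent_sum.
  exact: (prim_sum simple_e conn_e prim_E A1E th_inj).
- case=> k l kD lD; first exact: dual_idempotent_mul.
  exact: (prim_mul simple_e conn_e prim_E A1E th_inj).
- case=> k u v kD; first exact: dual_idempotent_herm.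
  exact: (prim_herm simple_e conn_e prim_E A1E th_inj).
- case=> k kD /=; first apply: (affine_eig alpha1_neq0 As_def).
    by rewrite -ths_eq //; apply: acts_as_image; apply: thsE.
  by apply: (affine_eig alpha1_neq0 A_def); rewrite -th_eq // A1E.
- have far_neq (k l : nat) : (k.+1 < l)%N || (l.+1 < k)%N -> (k == l) = false.
    by case: eqP => // ->; rewrite ltnNge leqnSn.
  case=> k l kD lD far /=.
    apply: (affine_sandwich alpha1_neq0 A_def).
      by rewrite dual_idempotent_mul far_neq.
    exact: (dual_idempotent_tri _ simple_e conn_e).
  apply: (affine_sandwich alpha1_neq0 As_def).
    by rewrite (prim_mul simple_e conn_e prim_E A1E th_inj) // far_neq.
  apply: (prim_dual_tri simple_e conn_e prim_E A1E th_inj x kr_E) => //.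
    exact: ltn_trans D3.
  (* Self-duality turns the Krein parameter into $p^1_{kl}$, which vanishes by the triangle
     inequality. *)
  rewrite sd //; last exact: ltn_trans D3.
  by rewrite (pnum1_far simple_e conn_e).
all: by [].
Qed.
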